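(* Let $X$ be a compact symplectic manifold (not necessarily monotone) and assume sufficient foundations have been established to define the Fukaya categories of $X$ over the Novikov field $\Lambda$ as strictly unital $A_\infty$-categories (Assumption (i) in the context). Let $R$ be a complete filtered augmented $\Lambda$-algebra and suppose an object $(L^\flat,b)$ of $\mathcal F(X)_\lambda$, $\lambda\in\Lambda$, lifts to $R$. Given a choice of lift $(\mathbf L,\mathbf b)$, with curvature $W_L\in R$, let $\mathcal{LM}:\mathcal F(X)_\lambda\to\operatorname{mf}=\operatorname{mf}(R,W_L-\lambda)$ be the localised mirror functor of $(\mathbf L,\mathbf b)$. Then there is a geometrically defined $R$-linear $A_\infty$-algebra homomorphism $$\Theta:\operatorname{CF}^*_R((\mathbf L,\mathbf b),(\mathbf L,\mathbf b))^{\mathrm{op}}\to\operatorname{CC}^*(\mathcal F(X)_\lambda,\operatorname{mf}),$$ given by the disc counts described in the context. It is cohomologically unital and extends the module action of $\operatorname{CF}^*_R((\mathbf L,\mathbf b),(\mathbf L,\mathbf b))^{\mathrm{op}}$ on $\mathcal{LM}$: for each object $K$, the projection of $\Theta^1$ to length zero on $K$ is homotopic to $T_K$.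
   Context: Novikov field and filtrations. $\Lambda=\{\sum_{j\ge1}a_jT^{s_j}:a_j\in\mathbb C,\ s_j\in\mathbb R,\ s_j\to\infty\}$, filtered by $\Lambda_{\ge s}$ (all exponents $\ge s$). A filtered abelian group $A$ carries a decreasing filtration $F^sA$, $s\in\mathbb R$, with $\bigcup_sF^sA=A$ and $\bigcap_sF^sA=0$; it is complete if $A\to\varprojlim A/F^sA$ is an isomorphism. A filtered $\Lambda$-algebra $R$ has $(F^{s}R)(F^{t}R)\subset F^{s+t}R$ and $\Lambda_{\ge s}\to F^sR$; if augmented, the augmentation $R\to\Lambda$ is filtered, with kernel $\mathfrak m$. A rank-1 local system over $R$ is $c$-filtered ($c\ge0$) if each fibre is filtered, isomorphic to $R$ as a filtered $R$-module, and each parallel transport map sends $F^s$ into $F^{s-c}$ for all $s$. Assumption (i). Sufficient technical foundations (virtual fundamental chains) exist to define the Fukaya category $\mathcal F(X)_\lambda$ over $\Lambda$, $\lambda\in\Lambda$, prove its $A_\infty$-relations, and make it strictly unital. Objects are compact connected Lagrangians $L\subset X$ with a pin structure, a $\mathbb Z/2$-grading, a $c$-filtered rank-1 local system over $\Lambda$ (for some $c$), forming $L^\flat$, and a weak bounding cochain $b\in F^{>c}\operatorname{CF}^{\mathrm{odd}}(L^\flat,L^\flat)$ of curvature $\lambda$. Operations count discs $u$ weighted by $T^{\omega(u)}$ and boundary parallel transport, with arbitrarily many insertions of the bounding cochains. The same foundations define $\mathcal F_R(X)_r$ over any complete filtered $\Lambda$-algebra $R$ ($r\in R$), with operations $\mu_R$,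 complexes $\operatorname{CF}_R^*$; objects over $\Lambda$ are viewed over $R$ by applying $R\otimes_\Lambda-$. Lifting. $(L^\flat,b)$, with local system $\mathcal L$, lifts to $R$ if there is a $c$-filtered rank-1 local system over $R$ on $L$ reducing to $\mathcal L$ modulo $\mathfrak m$, such that $L$ with this local system (and the same grading and pin structure), denoted $\mathbf L$, admits a weak bounding cochain $\mathbf b$ reducing to $b$ modulo $\mathfrak m$. Its curvature is denoted $W_L\in R$. Conventions. Seidel's $A_\infty$-conventions, inputs right to left; $\mu^1(a)=(-1)^{|a|}da$, $\mu^2(a_2,a_1)=(-1)^{|a_1|}a_2\circ a_1$; opposite $\mu_{\mathrm{op}}^l(c_l,\dots,c_1)=(-1)^{\triangle_l+l-1}\mu^l(c_1,\dots,c_l)$, $\triangle_l=\sum_{i<j}(|c_i|-1)(|c_j|-1)$. $\operatorname{mf}(R,w)$ is the dg-category of matrix factorisations of $w$ over $R$. $\mathcal{LM}$ sends $K$ to $\operatorname{CF}^*_R((\mathbf L,\mathbf b),K)$ with $dx=(-1)^{|x|}\mu_R^1(x)$, and $\mathcal{LM}^k(a_k,\dots,a_1)(x)=(-1)^{|x|}\mu_R^{k+1}(a_k,\dots,a_1,x)$. $\operatorname{CC}^*(\mathcal F(X)_\lambda,\operatorname{mf})$ is the Hochschild cochain complex of $\mathcal F(X)_\lambda$ with coefficients in $\operatorname{mf}$, viewed as a bimodule via $\mathcal{LM}$ (components in $\operatorname{hom}^*(\operatorname{CF}^*(K_{k-1},K_k)[1]\otimes\dots\otimes\operatorname{CF}^*(K_0,K_1)[1],\operatorname{hom}^*_{\operatorname{mf}}(\mathcal{LM}(K_0),\mathcal{LM}(K_k)))$),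 i.e. pre-natural endomorphisms of $\mathcal{LM}$: with $\maltese_i=\sum_{j\le i}(|a_j|-1)$, $\mu^1(\phi)=\mu^1_{\operatorname{mf}}(\phi(\dots))+\sum\mu^2_{\operatorname{mf}}(\mathcal{LM}(\dots),\phi(\dots))+\sum(-1)^{(|\phi|-1)\maltese_i}\mu^2_{\operatorname{mf}}(\phi(\dots),\mathcal{LM}(a_i,\dots,a_1))+\sum(-1)^{|\phi|+\maltese_i}\phi(\dots,\mu_{\mathcal F}(\dots),a_i,\dots,a_1)$, $\mu^2(\psi,\phi)=\sum(-1)^{(|\psi|-1)\maltese_i}\mu^2_{\operatorname{mf}}(\psi(\dots),\phi(a_i,\dots,a_1))$, $\mu^{\ge3}=0$. Definition of $\Theta$. $\Theta^l(c_l,\dots,c_1)(a_k,\dots,a_1)(x)\in\operatorname{CF}^*_R((\mathbf L,\mathbf b),K_k)$ counts rigid discs whose boundary is divided by the input $x\in\operatorname{CF}^*_R((\mathbf L,\mathbf b),K_0)$ and the output into an arc carrying $a_1,\dots,a_k$ ($a_i\in\operatorname{CF}^*(K_{i-1},K_i)$) anticlockwise with boundary conditions $K_0,\dots,K_k$, and an arc on $(\mathbf L,\mathbf b)$ carrying $c_1,\dots,c_l$ clockwise; each disc counts as in $\mu_R^{k+l+1}(a_k,\dots,a_1,x,c_1,\dots,c_l)$ times $(-1)^{(\square_l-1)(|x|-1)+\triangle_l+l-1}$, $\square_l=\sum_j(|c_j|-1)$. The module action is $T_K(c)(x)=(-1)^{|c||x|+|c|}\mu_R^2(x,c)$ in $\operatorname{end}^*_{\operatorname{mf}}(\mathcal{LM}(K))$.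 *)

(* Defs.v *)
From HB Require Import structures.
From mathcomp Require Import all_boot all_order all_algebra.
From mathcomp Require Import complex lra.
From mathcomp Require Import all_classical all_reals all_analysis.
Set Implicit Arguments.
Unset Strict Implicit.
Unset Printing Implicit Defensive.
Import Order.TTheory GRing.Theory Num.Theory.
Import numFieldNormedType.Exports.
Local Open Scope classical_set_scope.
Local Open Scope ring_scope.

Section Novikov.
(* K is the field of real numbers *)
Variable K : realType.
Local Notation C := (complex K).

Definition left_finite (f : K -> C) : Prop :=
  forall s, finite_set [set t | t <= s /\ f t != 0].

(* f stands for the sum of the f(s) T^s; the supports are exactly the sets of
   exponents that are finite or tend to infinity. *)
Record novikov := Novikov { ncoef :> K -> C; ncoefP : left_finite ncoef }.

Lemma novikovP (f g : novikov) : ncoef f =1 ncoef g -> f = g.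
Proof.
case: f g => f Pf [g Pg] /= /funext fg; rewrite -{}fg in Pg *.
by congr Novikov; apply: Prop_irrelevance.
Qed.


HB.instance Definition _ := gen_eqMixin novikov.
HB.instance Definition _ := gen_choiceMixin novikov.

Lemma left_finite0 : left_finite (fun=> 0).
Proof.
move=> s; rewrite (_ : [set _ | _] = set0)//.
by apply/seteqP; split => // t /= []; rewrite eqxx.
Qed.

Lemma left_finiteD (f g : novikov) : left_finite (fun t => f t + g t).
Proof.
move=> s; apply: (@sub_finite_set _ _
    ([set t | t <= s /\ f t != 0] `|` [set t | t <= s /\ g t != 0])).
  move=> t /= [ts fg]; have [f0|] := eqVneq (f t) 0; last by left.
  by right; split => //; move: fg; rewrite f0 add0r.
by rewrite finite_setU; split; apply: ncoefP.
Qed.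

Lemma left_finiteN (f : novikov) : left_finite (fun t => - f t).
Proof.
by move=> s; under eq_set do rewrite oppr_eq0; apply: ncoefP.
Qed.

Definition nzero := Novikov left_finite0.
Definition nadd f g := Novikov (left_finiteD f g).
Definition nopp f := Novikov (left_finiteN f).

Lemma naddA : associative nadd.
Proof. by move=> f g h; apply: novikovP => t /=; rewrite addrA. Qed.
Lemma naddC : commutative nadd.
Proof. by move=> f g; apply: novikovP => t /=; rewrite addrC. Qed.
Lemma nadd0 : left_id nzero nadd.
Proof. by move=> f; apply: novikovP => t /=; rewrite add0r. Qed.
Lemma naddN : left_inverse nzero nopp nadd.
Proof. by move=> f; apply: novikovP => t /=; rewrite addNr. Qed.

HB.instance Definition _ := GRing.isZmodule.Build novikov naddA naddC nadd0 naddN.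

Lemma nov_list (f : novikov) s : exists A : seq K, uniq A /\
  forall t, t \in A <-> (t <= s /\ f t != 0).
Proof.
have /finite_fsetP [A AE] := ncoefP f s.
exists (finmap.enum_fset A); split; first exact: finmap.fset_uniq.
move=> t; have := AE; move/seteqP => [h1 h2]; split; first by move/h2.
by move/h1.
Qed.

Lemma nov_lb (f : novikov) : exists l, forall t, f t != 0 -> l <= t.
Proof.
have [A [_ AP]] := nov_list f 0.
exists (\big[Num.min/0]_(a <- A) a) => t ft.
have [t0|/ltW t0] := leP t 0.
  have /AP tA : t <= 0 /\ f t != 0 by [].
  elim: A {AP} tA => // a A IH; rewrite inE big_cons => /orP[/eqP ->|/IH h].
    by rewrite ge_min lexx.
  by rewrite ge_min h orbT.
apply: le_trans t0; elim: A {AP} => [|a A IH]; first by rewrite big_nil.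
by rewrite big_cons ge_min IH orbT.
Qed.

Definition nmulc (f g : novikov) (t : K) : C :=
  \sum_(s \in [set: K]) f s * g (t - s).

Lemma nmulcE (f g : novikov) t (A : seq K) : uniq A ->
  (forall a, f a != 0 -> g (t - a) != 0 -> a \in A) ->
  nmulc f g t = \sum_(a <- A) f a * g (t - a).
Proof.
move=> uA AP; rewrite fsbig_seq// /nmulc; apply/esym/fsbig_widen => // a [_ /= aA].
have [->|f0] := eqVneq (f a) 0; first by rewrite mul0r.
have [->|g0] := eqVneq (g (t - a)) 0; first by rewrite mulr0.
by case: aA; exact: AP f0 g0.
Qed.

Lemma nmulc_list (f g : novikov) t : exists A : seq K, uniq A /\
  (forall a, f a != 0 -> g (t - a) != 0 -> a \in A).
Proof.
have [l lP] := nov_lb g; have [A [uA AP]] := nov_list f (t - l).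
by exists A; split => // a fa /lP ga; apply/AP; split => //; rewrite lerBrDr -lerBrDl.
Qed.

Lemma nmulc_neq0 (f g : novikov) t : nmulc f g t != 0 ->
  exists a, f a != 0 /\ g (t - a) != 0.
Proof.
have [A [uA AP]] := nmulc_list f g t.
rewrite (nmulcE uA AP) => h; apply: contrapT => nh.
move/negP: h; apply; apply/eqP; rewrite big1_seq// => a _.
have [->|fa] := eqVneq (f a) 0; first by rewrite mul0r.
have [->|ga] := eqVneq (g (t - a)) 0; first by rewrite mulr0.
by case: nh; exists a.
Qed.

Lemma nmul_list (f g : novikov) s : exists D : seq K, uniq D /\
  forall a b, f a != 0 -> g b != 0 -> a + b <= s -> a + b \in D.
Proof.
have [l lP] := nov_lb g; have [A [uA AP]] := nov_list f (s - l).
have [m mP] := nov_lb f; have [B [uB BP]] := nov_list g (s - m).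
exists (undup [seq a + b | a <- A, b <- B]); split; first exact: undup_uniq.
move=> a b fa gb ab; rewrite mem_undup; apply: allpairs_f.
  by apply/AP; split => //; rewrite lerBrDr (le_trans _ ab)// lerD2l lP.
by apply/BP; split => //; rewrite lerBrDr (le_trans _ ab)// addrC lerD2r mP.
Qed.

Lemma left_finiteM (f g : novikov) : left_finite (nmulc f g).
Proof.
move=> s; have [D [uD DP]] := nmul_list f g s.
apply: (@sub_finite_set _ _ [set` D]); last exact: finite_seq.
move=> t /= [ts /nmulc_neq0[a [fa ga]]].
by rewrite -(subrK a t) addrC; apply: DP => //; rewrite addrC subrK.
Qed.

Definition nmul f g := Novikov (left_finiteM f g).

Lemma nmulC : commutative nmul.
Proof.
move=> f g; apply: novikovP => t /=.
have [A [uA AP]] := nmulc_list f g t.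
rewrite (nmulcE uA AP) (@nmulcE _ _ _ [seq t - a | a <- A]).
- by rewrite big_map; apply: eq_bigr => a _; rewrite subKr mulrC.
- by rewrite map_inj_uniq// => a b /addrI/oppr_inj.
- move=> b gb fb; rewrite -(subKr t b); apply: map_f; apply: AP => //.
  by rewrite subKr.
Qed.

Lemma nmulDl : left_distributive nmul nadd.
Proof.
move=> f g h; apply: novikovP => t /=.
have [A [uA AP]] := nmulc_list f h t.
have [B [uB BP]] := nmulc_list g h t.
have uAB : uniq (undup (A ++ B)) by exact: undup_uniq.
rewrite !(@nmulcE _ _ _ (undup (A ++ B)))//.
- by rewrite -big_split; apply: eq_bigr => a _ /=; rewrite mulrDl.
- by move=> a ga ha; rewrite mem_undup mem_cat BP ?orbT.
- by move=> a fa ha; rewrite mem_undup mem_cat AP.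
- move=> a /= fg ha; rewrite mem_undup mem_cat.
  have [f0|f0] := eqVneq (f a) 0; last by rewrite AP.
  by rewrite BP ?orbT//; move: fg; rewrite f0 add0r.
Qed.

Lemma nmulA : associative nmul.
Proof.
move=> f g h; apply: novikovP => t /=.
have [lg lgP] := nov_lb g; have [lh lhP] := nov_lb h.
have [A [uA AP]] := nov_list f (t - lh - lg).
have [D [uD DP]] := nmul_list f g (t - lh).
rewrite (@nmulcE f (nmul g h) t A)//; last first.
  move=> a fa /nmulc_neq0[b [gb hb]]; apply/AP; split => //.
  by have := lgP _ gb; have := lhP _ hb; lra.
rewrite (@nmulcE (nmul f g) h t D)//; last first.
  move=> d /= /nmulc_neq0[a [fa ga]] /lhP hd.
  rewrite -(subrK a d) addrC; apply: DP => //.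
  by lra.
transitivity (\sum_(d <- D) \sum_(a <- A) f a * (g (d - a) * h (t - d))).
  rewrite exchange_big /=; apply: eq_big_seq => a aA.
  rewrite -big_distrr /=; have [fa|fa] := eqVneq (f a) 0.
    by rewrite fa !mul0r.
  congr (_ * _); rewrite (@nmulcE _ _ _ [seq d - a | d <- D]).
  - by rewrite big_map; apply: eq_bigr => d _; congr (_ * h _); lra.
  - by rewrite map_inj_uniq// => ? ? /addIr.
  - move=> b gb /lhP hb; rewrite -(addrK a b); apply: map_f.
    by rewrite addrC; apply: DP => //; lra.
apply: eq_big_seq => d dD; have [hd|hd] := eqVneq (h (t - d)) 0.
  by rewrite hd mulr0 big1// => a _; rewrite !mulr0.
have -> : nmul f g d = \sum_(a <- A) f a * g (d - a).
  apply: nmulcE => // a fa /lgP ga; apply/AP; split => //.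
  by have := lhP _ hd; lra.
by rewrite big_distrl /=; apply: eq_bigr => a _; rewrite mulrA.
Qed.

Definition nmonc (c : C) (s t : K) : C := if t == s then c else 0.

Lemma left_finite_mon c s : left_finite (nmonc c s).
Proof.
move=> r; apply: (@sub_finite_set _ _ [set s]); last exact: finite_set1.
move=> t [_ /eqP].
by rewrite /nmonc; case: (t =P s).
Qed.

(* [nmon c s] is [c T^s]. *)
Definition nmon c s := Novikov (left_finite_mon c s).

Lemma nmul1 : left_id (nmon 1 0) nmul.
Proof.
move=> f; apply: novikovP => t /=.
rewrite (@nmulcE _ _ _ [:: 0])//.
  by rewrite big_seq1 /= /nmonc eqxx mul1r subr0.
move=> a /eqP + _; rewrite /= /nmonc mem_seq1.
by case: (a =P 0).
Qed.

Lemma nov1_neq0 : nmon 1 0 != 0 :> novikov.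
Proof.
apply/eqP => /(congr1 (fun f : novikov => f 0)) /=.
by rewrite /nmonc eqxx => /eqP; rewrite oner_eq0.
Qed.

HB.instance Definition _ := GRing.Zmodule_isComNzRing.Build novikov
  nmulA nmulC nmul1 nmulDl nov1_neq0.

(* Lambda_{>= s} *)
Definition nov_fil (s : K) : set novikov := [set f | forall t, t < s -> f t = 0].
End Novikov.

Section Filtrations.
Variable K : realType.

Record is_filtration (A : zmodType) (F : K -> set A) : Prop := {
  fil0 : forall s, F s 0;
  filB : forall s a b, F s a -> F s b -> F s (a - b);
  fil_decr : forall s t, s <= t -> F t `<=` F s;
  fil_exh : forall a, exists s, F s a;
  fil_sep : forall a, (forall s, F s a) -> a = 0 }.

(* surjectivity of A -> lim A/F^s; injectivity is fil_sep *)
Definition fil_complete (A : zmodType) (F : K -> set A) : Prop :=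
  forall x : K -> A, (forall s t, s <= t -> F s (x t - x s)) ->
  exists a, forall s, F s (a - x s).

(* unordered convergence in the topology of the filtration *)
Definition is_sum (A : zmodType) (F : K -> set A) (I : choiceType)
    (t : I -> A) (a : A) : Prop :=
  forall s, exists2 S : seq I, uniq S & forall S' : seq I, uniq S' ->
    {subset S <= S'} -> F s (a - \sum_(i <- S') t i).

(* complete filtered (commutative) Lambda-algebras *)
Record cfalg := CFAlg {
  ca_alg :> comAlgType (novikov K);
  ca_fil : K -> set ca_alg;
  ca_filP : is_filtration ca_fil;
  ca_filM : forall s t a b, ca_fil s a -> ca_fil t b -> ca_fil (s + t) (a * b);
  ca_filA : forall s x, nov_fil s x -> ca_fil s x%:A;
  ca_cpl : fil_complete ca_fil }.

Lemma nov_filP : is_filtration (@nov_fil K).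
Proof.
split=> //.
- by move=> s a b ha hb t ts /=; rewrite ha// hb// subr0.
- by move=> s t st a ha r rs; apply: ha; apply: lt_le_trans st.
- move=> a; have [l lP] := nov_lb a; exists l => t tl.
  by apply: contraTeq tl => /lP; rewrite -leNgt.
- by move=> a ha; apply: novikovP => t; apply: (ha (t + 1)); rewrite ltrDl.
Qed.

Lemma nov_filM s t (a b : novikov K) :
  nov_fil s a -> nov_fil t b -> nov_fil (s + t) (a * b).
Proof.
move=> ha hb r rst /=; apply: contrapT => /eqP /nmulc_neq0 [x [ax bx]].
have sx : s <= x by rewrite leNgt; apply: contra ax => /ha ->.
have tx : t <= r - x by rewrite leNgt; apply: contra bx => /hb ->.
by lra.
Qed.

Lemma nov_cpl : fil_complete (@nov_fil K).
Proof.
move=> x xP; have E r s t : t < r -> t < s -> x r t = x s t.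
  wlog rs : r s / r <= s => [hw|].
    by case/orP: (le_total r s) => h h1 h2; [|symmetry]; apply: hw.
  by move=> tr _; apply/esym/eqP; rewrite -subr_eq0; apply/eqP; apply: (xP r s).
have lf : left_finite (fun t => x (t + 1) t).
  move=> s; apply: (@sub_finite_set _ _ [set t | t <= s /\ x (s + 1) t != 0]).
    move=> t /= [ts]; rewrite (E _ (s + 1))//; first by rewrite ltrDl.
    by rewrite (le_lt_trans ts)// ltrDl.
  exact: ncoefP.
exists (Novikov lf) => s t ts /=.
by rewrite (E _ s)// ?ltrDl// subrr.
Qed.

Lemma nov_filA s (x : novikov K) : nov_fil s x ->
  nov_fil s (x%:A : (novikov K)^o).
Proof. by move=> h; rewrite /GRing.scale /= mulr1. Qed.

Definition nov_cfalg : cfalg := @CFAlg (novikov K)^o (@nov_fil K)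
  nov_filP nov_filM nov_filA nov_cpl.
End Filtrations.

Section Symplectic.
Variable K : realType.

Definition partial m (i : 'I_m) (f : 'rV[K]_m -> K) : 'rV[K]_m -> K :=
  fun x => 'D_(delta_mx 0 i : 'rV[K]_m) f x.

Definition smooth_on m (U : set 'rV[K]_m) (f : 'rV[K]_m -> K) : Prop :=
  forall (s : seq 'I_m) x, U x ->
    {for x, continuous (foldr (@partial m) f s)} /\
    forall i, derivable (foldr (@partial m) f s) x (delta_mx 0 i : 'rV[K]_m).

Definition smooth_map m n (U : set 'rV[K]_m) (f : 'rV[K]_m -> 'rV[K]_n) : Prop :=
  forall j, smooth_on U (fun x => f x 0 j).

(* Row vectors: the differential of f at x is v |-> v *m jac f x. *)
Definition jac m n (f : 'rV[K]_m -> 'rV[K]_n) (x : 'rV[K]_m) : 'M[K]_(m, n) :=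
  \matrix_(i, j) partial i (fun y => f y 0 j) x.

Record symplectic := Symplectic {
  sy_car :> topologicalType;
  sy_hausdorff : hausdorff_space sy_car;
  sy_compact : compact [set: sy_car];
  sy_n : nat;
  sy_chart : Type;
  sy_dom : sy_chart -> set sy_car;
  sy_img : sy_chart -> set 'rV[K]_sy_n.*2;
  sy_coord : sy_chart -> sy_car -> 'rV[K]_sy_n.*2;
  sy_par : sy_chart -> 'rV[K]_sy_n.*2 -> sy_car;
  sy_domO : forall i, open (sy_dom i);
  sy_imgO : forall i, open (sy_img i);
  sy_cover : forall p, exists i, sy_dom i p;
  sy_coordP : forall i p, sy_dom i p ->
    [/\ sy_img i (sy_coord i p), sy_par i (sy_coord i p) = p
      & {for p, continuous (sy_coord i)}];
  sy_parP : forall i x, sy_img i x ->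
    [/\ sy_dom i (sy_par i x), sy_coord i (sy_par i x) = x
      & {for x, continuous (sy_par i)}];
  sy_trans : forall i j,
    smooth_map (sy_coord i @` (sy_dom i `&` sy_dom j)) (sy_coord j \o sy_par i);
  (* matrix of the symplectic form in the chart i, acting on row vectors *)
  sy_form : sy_chart -> 'rV[K]_sy_n.*2 -> 'M[K]_sy_n.*2;
  sy_form_smooth : forall i a b, smooth_on (sy_img i) (fun x => sy_form i x a b);
  sy_form_alt : forall i x, sy_img i x -> (sy_form i x)^T = - sy_form i x;
  sy_form_nondeg : forall i x, sy_img i x -> sy_form i x \in unitmx;
  sy_form_closed : forall i x a b c, sy_img i x ->
    partial a (fun y => sy_form i y b c) x + partial b (fun y => sy_form i y c a) x
      + partial c (fun y => sy_form i y a b) x = 0;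
  sy_form_glue : forall i j x, (sy_coord i @` (sy_dom i `&` sy_dom j)) x ->
    let J := jac (sy_coord j \o sy_par i) x in
    sy_form i x = J *m sy_form j (sy_coord j (sy_par i x)) *m J^T }.

Definition plane (v : 'rV[K]_2) : K * K := (v 0 0, v 0 1).
Definition open_disc : set (K * K) := [set z | z.1 ^+ 2 + z.2 ^+ 2 < 1].
Definition closed_disc : set (K * K) := [set z | z.1 ^+ 2 + z.2 ^+ 2 <= 1].
Definition circ (t : K) : K * K := (cos (2 * pi * t), sin (2 * pi * t)).

Variable X : symplectic.

(* Embedded Lagrangian submanifolds, through local parametrisations g with
   continuous inverse h on the image. *)
Record lagrangian := Lagrangian {
  lag_set :> set X;
  lag_nonempty : lag_set !=set0;
  lag_compact : compact lag_set;
  lag_connected : connected lag_set;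
  lag_param : forall p, lag_set p -> exists (i : sy_chart X) (V : set X)
      (W : set 'rV[K]_(sy_n X)) (g : 'rV[K]_(sy_n X) -> 'rV[K]_(sy_n X).*2)
      (h : 'rV[K]_(sy_n X).*2 -> 'rV[K]_(sy_n X)),
    [/\ open V, V p, V `<=` sy_dom i & open W] /\
    [/\ smooth_map W g, g @` W = sy_coord i @` (lag_set `&` V),
        (forall w, W w -> h (g w) = w), {within g @` W, continuous h}
      & forall w, W w -> \rank (jac g w) = sy_n X /\
          jac g w *m sy_form i (g w) *m (jac g w)^T = 0] }.

Definition is_path (L : set X) (c : K -> X) : Prop :=
  {within `[0, 1], continuous c} /\ forall t, 0 <= t <= 1 -> L (c t).

Definition path_cat (c d : K -> X) : K -> X :=
  fun t => if t <= 2^-1 then c (2 * t) else d (2 * t - 1).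

Definition path_homotopic (L : set X) (c d : K -> X) : Prop :=
  exists H : K * K -> X,
    {within `[0, 1] `*` `[0, 1], continuous H} /\
    forall s t, 0 <= s <= 1 -> 0 <= t <= 1 ->
      [/\ L (H (s, t)), H (0, t) = c t, H (1, t) = d t,
          H (s, 0) = c 0 & H (s, 1) = c 1].

Definition smooth_disc (u : K * K -> X) : Prop :=
  {within closed_disc, continuous u} /\
  forall v : 'rV[K]_2, open_disc (plane v) -> exists i W,
    [/\ open W, W v, forall w, W w -> sy_dom i (u (plane w))
      & smooth_map W (fun w => sy_coord i (u (plane w)))].

(* f(s,t) ds dt = u^* omega, with omega evaluated in any chart around u(s,t). *)
Definition is_pullback (u : K * K -> X) (f : K * K -> K) : Prop :=
  forall (v : 'rV[K]_2) i, open_disc (plane v) -> sy_dom i (u (plane v)) ->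
  let J := jac (fun w => sy_coord i (u (plane w))) v in
  f (plane v) = (J *m sy_form i (sy_coord i (u (plane v))) *m J^T) 0 1.

Definition is_area (u : K * K -> X) (a : K) : Prop :=
  let mu2 := (@lebesgue_measure K \x @lebesgue_measure K)%E in
  exists2 f, is_pullback u f &
    mu2.-integrable open_disc (EFin \o f) /\ a = Rintegral mu2 open_disc f.

End Symplectic.

Section Floer.
Variables (K : realType) (X : symplectic K).

(* Pin structures and Z/2-gradings only enter through the virtual counts and the
   parities of generators, and are kept abstract. *)
Record decorations := Decorations {
  pin_structure : lagrangian X -> Type;
  z2_grading : lagrangian X -> Type }.

Record brane (D : decorations) := Brane {
  br_lag :> lagrangian X;
  br_pin : pin_structure D br_lag;
  br_gr : z2_grading D br_lag }.

(* A generator of CF(L0, L1) is a chord from L0 to L1: a constant one for an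
   intersection point, a Hamiltonian chord for perturbed Floer data. *)
Record floer_data := FloerData {
  fd_dec : decorations;
  fd_gen : choiceType;
  fd_gens : brane fd_dec -> brane fd_dec -> seq fd_gen;
  fd_parity : brane fd_dec -> brane fd_dec -> fd_gen -> bool;
  fd_chord : brane fd_dec -> brane fd_dec -> fd_gen -> K -> X;
  fd_chordP : forall L0 L1 g, g \in fd_gens L0 L1 ->
    [/\ is_path setT (fd_chord L0 L1 g), lag_set L0 (fd_chord L0 L1 g 0)
      & lag_set L1 (fd_chord L0 L1 g 1)] }.

Variable F : floer_data.
Local Notation Br := (brane (fd_dec F)).

Fixpoint composable (L : Br) (ins : seq (fd_gen F * Br)) : Prop :=
  if ins is (g, L') :: ins' then g \in fd_gens L L' /\ composable L' ins' else True.

(* Inputs g_1, ..., g_d in anticlockwise order from the output, stored with the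
   branes L_1, ..., L_d; rd_src is L_0.  The boundary circle is cut at
   0 = rd_cut 0 <= ... <= rd_cut (2d+2) = 1 into arcs (even sides) on the L_i and
   chords (odd sides); the output chord runs from L_0 to L_d, hence backwards. *)
Record disc := Disc {
  rd_src : Br;
  rd_in : seq (fd_gen F * Br);
  rd_out : fd_gen F;
  rd_map : K * K -> X;
  rd_cut : nat -> K;
  rd_area : K;
  rd_tgt := last rd_src (unzip2 rd_in);
  rd_side j s := rd_map (circ (rd_cut j + s * (rd_cut j.+1 - rd_cut j)));
  rd_composable : composable rd_src rd_in;
  rd_outP : rd_out \in fd_gens rd_src rd_tgt;
  rd_smooth : smooth_disc rd_map;
  rd_areaP : is_area rd_map rd_area;
  rd_cutP : [/\ rd_cut 0 = 0, rd_cut (size rd_in).+1.*2 = 1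
              & forall j, (j < (size rd_in).+1.*2)%N -> rd_cut j <= rd_cut j.+1];
  rd_arcP : forall i s, (i <= size rd_in)%N -> 0 <= s <= 1 ->
    lag_set (nth rd_src (rd_src :: unzip2 rd_in) i) (rd_side i.*2 s);
  rd_chordP : forall i s, (i < size rd_in)%N -> 0 <= s <= 1 ->
    rd_side i.*2.+1 s =
      fd_chord (nth rd_src (rd_src :: unzip2 rd_in) i)
               (nth rd_src (unzip2 rd_in) i) (nth rd_out (unzip1 rd_in) i) s;
  rd_outchordP : forall s, 0 <= s <= 1 ->
    rd_side (size rd_in).*2.+1 s = fd_chord rd_src rd_tgt rd_out (1 - s) }.

Definition rd_arc (u : disc) (i : nat) : K -> X := rd_side u i.*2.

(* Rank one: each fibre is identified with R by a filtered trivialisation, so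
   that parallel transport along c is multiplication by ls_hol c. *)
Record local_system (R : cfalg K) (L : set X) := LocalSystem {
  ls_hol :> (K -> X) -> R;
  ls_cst : forall p, L p -> ls_hol (fun=> p) = 1;
  ls_cat : forall c d, is_path L c -> is_path L d -> c 1 = d 0 ->
    ls_hol (path_cat c d) = ls_hol d * ls_hol c;
  ls_htpy : forall c d, is_path L c -> is_path L d -> path_homotopic L c d ->
    ls_hol c = ls_hol d }.

Definition c_filtered (R : cfalg K) (L : set X) (E : local_system R L) (c : K) :=
  0 <= c /\ forall p s v, is_path L p -> ca_fil s v -> ca_fil (s - c) (E p * v).

Section Complexes.
Variable R : cfalg K.

Definition CF (L0 L1 : Br) := {ffun seq_sub (fd_gens L0 L1) -> R^o}.

Definition homog L0 L1 (d : bool) (a : CF L0 L1) : Prop :=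
  forall i, fd_parity L0 L1 (ssval i) != d -> a i = 0.

Definition CF_fil L0 L1 (s : K) : set (CF L0 L1) := [set a | forall i, ca_fil s (a i)].

Definition coef L0 L1 (a : CF L0 L1) (g : fd_gen F) : R :=
  if insub g is Some i then a i else 0.

(* the involution a |-> (-1)^|a| a *)
Definition koszul L0 L1 (a : CF L0 L1) : CF L0 L1 :=
  [ffun i => (-1) ^+ fd_parity L0 L1 (ssval i) *: a i].

(* (L^flat, b) over R, before any condition on the curvature of b *)
Record robj := RObj {
  ro_br :> Br;
  ro_ls : local_system R ro_br;
  ro_b : CF ro_br ro_br;
  ro_odd : homog true ro_b;
  ro_fil : exists c, c_filtered ro_ls c /\ exists2 s, c < s & CF_fil s ro_b }.
End Complexes.

Definition ls_bc (R : cfalg K) (L : set X) (E : local_system (nov_cfalg K) L) :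
  local_system R L.
Proof.
apply: (@LocalSystem R L (fun c => (E c : novikov K)%:A)).
- by move=> p Lp; rewrite ls_cst// scale1r.
- by move=> c d cP dP cd; rewrite ls_cat// -[in RHS]scalerAl mul1r scalerA.
- by move=> c d cP dP cd; rewrite (ls_htpy E cP dP cd).
Defined.

Definition CF_bc (R : cfalg K) L0 L1 (a : CF (nov_cfalg K) L0 L1) : CF R L0 L1 :=
  [ffun i => (a i : novikov K)%:A : R].

Lemma homog_bc (R : cfalg K) L0 L1 d (a : CF (nov_cfalg K) L0 L1) :
  homog d a -> homog d (CF_bc R a).
Proof. by move=> h i hi; rewrite ffunE h// scale0r. Qed.

Lemma c_filtered_bc (R : cfalg K) (L : set X) (E : local_system (nov_cfalg K) L) c :
  c_filtered E c -> c_filtered (ls_bc R E) c.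
Proof.
move=> [c0 h]; split=> // p s v pL sv /=; rewrite addrC.
apply: ca_filM sv; apply: ca_filA; have := h p 0 1 pL.
by rewrite sub0r mulr1; apply => t t0 /=; rewrite /nmonc lt_eqF.
Qed.

Lemma ro_fil_bc (R : cfalg K) (Y : robj (nov_cfalg K)) :
  exists c, c_filtered (ls_bc R (ro_ls Y)) c /\
    exists2 s, c < s & CF_fil s (CF_bc R (ro_b Y)).
Proof.
have [c [cY [s cs bs]]] := ro_fil Y; exists c; split; first exact: c_filtered_bc.
by exists s => // i; rewrite ffunE; apply: ca_filA; apply: bs.
Qed.

(* R (x)_Lambda Y, in the trivialisation of the fibres induced from Lambda *)
Definition ro_bc (R : cfalg K) (Y : robj (nov_cfalg K)) : robj R :=
  @RObj R (ro_br Y) (ls_bc R (ro_ls Y)) (CF_bc R (ro_b Y))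
    (homog_bc R (ro_odd (r:=Y))) (ro_fil_bc R Y).

End Floer.

(* [cpath E x y]: composable words a_k, ..., a_1 with a_1 out of x and a_k into
   y; [psnoc] adds the leftmost letter. *)
Section Words.
Variables (V : Type) (E : V -> V -> Type).

Inductive cpath (x : V) : V -> Type :=
| pnil : cpath x x
| psnoc y z : cpath x y -> E y z -> cpath x z.

(* inputs of p first *)
Fixpoint pcat x y z (p : cpath x y) (q : cpath y z) : cpath x z :=
  match q in cpath _ z return cpath x z with
  | pnil => p
  | psnoc _ _ q' a => psnoc (pcat p q') a
  end.

Fixpoint plen x y (p : cpath x y) : nat :=
  if p is psnoc _ _ p' _ then (plen p').+1 else 0%N.

Record split2 x z := Split2 {
  sp_mid : V;
  sp_fst : cpath x sp_mid;
  sp_snd : cpath sp_mid z }.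

(* the factorisations p = pcat sp_fst sp_snd, both possibly empty *)
Fixpoint splits x z (p : cpath x z) : seq (split2 x z) :=
  match p in cpath _ z return seq (split2 x z) with
  | pnil => [:: Split2 (pnil x) (pnil x)]
  | psnoc _ _ p' a =>
      rcons [seq Split2 (sp_fst s) (psnoc (sp_snd s) a) | s <- splits p']
            (Split2 (psnoc p' a) (pnil _))
  end.
End Words.
Arguments pnil {V E x}.

Fixpoint pmap (V W : Type) (E : V -> V -> Type) (E' : W -> W -> Type) (f : V -> W)
    (h : forall x y, E x y -> E' (f x) (f y)) x y (p : cpath E x y) :
    cpath E' (f x) (f y) :=
  match p in cpath _ _ y return cpath E' (f x) (f y) with
  | pnil => pnil
  | psnoc _ _ p' a => psnoc (pmap h p') (h _ _ a)
  end.


Section DegreedWords.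
Variables (V : Type) (E : V -> V -> Type).

(* letters with a declared degree in Z/2 *)
Definition dE x y : Type := (bool * E x y)%type.

Fixpoint vals x y (p : cpath dE x y) : cpath E x y :=
  match p in cpath _ _ y return cpath E x y with
  | pnil => pnil
  | psnoc _ _ p' a => psnoc (vals p') a.2
  end.

(* the sum of the |a_j| - 1, modulo 2 *)
Fixpoint sdeg x y (p : cpath dE x y) : nat :=
  if p is psnoc _ _ p' a then sdeg p' + a.1.+1 else 0.

Fixpoint all_letters (P : forall x y, dE x y -> Prop) x y (p : cpath dE x y) : Prop :=
  if p is psnoc _ _ p' a then all_letters P p' /\ P _ _ a else True.
End DegreedWords.

Section Operations.
Variables (K : realType) (X : symplectic K) (F : floer_data X).
Local Notation Br := (brane (fd_dec F)).

Definition CFo (R : cfalg K) (Y Z : robj F R) := CF R Y Z.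
Arguments CFo : clear implicits.

Definition word1 R (Y Z : robj F R) (a : CF R Y Z) : cpath (CFo R) Y Z :=
  psnoc (E := CFo R) pnil a.
Definition word2 R (Y1 Y2 Y3 : robj F R) (a1 : CF R Y1 Y2) (a2 : CF R Y2 Y3) :
  cpath (CFo R) Y1 Y3 := psnoc (E := CFo R) (word1 a1) a2.

Section DiscCounts.
Variables (R : cfalg K).

Local Notation flat_word := (seq ((fd_gen F -> R) * robj F R)).

Fixpoint flat (Y Z : robj F R) (p : cpath (CFo R) Y Z) : flat_word :=
  if p is psnoc _ Z' p' a then rcons (flat p') (coef a, Z') else [::].

(* insert ns_i copies of the bounding cochain at the i-th object *)
Fixpoint insert_b (ns : seq nat) (Y : robj F R) (w : flat_word) : flat_word :=
  nseq (head 0%N ns) (coef (ro_b Y), Y) ++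
  (if w is (a, Z) :: w' then (a, Z) :: insert_b (behead ns) Z w' else [::]).

(* a_d(g_d) ... a_1(g_1) with the holonomies of the arcs i, ..., i + d; zero unless
   the boundary conditions of the word are those of the disc *)
Fixpoint weight (arc : nat -> K -> X) (i : nat) (Y : robj F R) (w : flat_word)
    (ins : seq (fd_gen F * Br)) : R :=
  match w, ins with
  | [::], [::] => ro_ls Y (arc i)
  | (a, Z) :: w', (g, L) :: ins' =>
      if `[< ro_br Z = L >] then weight arc i.+1 Z w' ins' * a g * ro_ls Y (arc i)
      else 0
  | _, _ => 0
  end.

(* contribution to mu(p) of the disc u, counted n times, with insertions ns *)
Definition contrib (Y Z : robj F R) (p : cpath (CFo R) Y Z) (ns : seq nat)
    (u : disc F) (n : complex K) : CF R Y Z :=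
  [ffun g => if [&& size ns == (plen p).+1, `[< ro_br Y = rd_src u >]
                  & ssval g == rd_out u]
     then nmon n (rd_area u) *:
          (weight (rd_arc u) 0 Y (insert_b ns Y (flat p)) (rd_in u) : R)
     else 0].
End DiscCounts.

Definition homogo (R : cfalg K) (Y Z : robj F R) (a : dE (CFo R) Y Z) : Prop :=
  homog a.1 a.2.

Definition hword (R : cfalg K) (Y Z : robj F R) (p : cpath (dE (CFo R)) Y Z) :=
  all_letters (@homogo R) p.

(* The assumed foundations.  fo_count is the virtual count of rigid discs in each
   class.  mu_R is already deformed by the bounding cochains of the objects, which may
   have different curvatures; mu of an empty word is the curvature term, and the
   relations mu_ainf are the curved ones. *)
Record foundations := Foundations {
  fo_idx : choiceType;
  fo_disc : fo_idx -> disc F;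
  fo_count : fo_idx -> complex K;
  mu : forall (R : cfalg K) (Y Z : robj F R), cpath (CFo R) Y Z -> CF R Y Z;
  unit_cf : forall (R : cfalg K) (Y : robj F R), CF R Y Y;
  mu_count : forall R (Y Z : robj F R) (p : cpath (CFo R) Y Z),
    is_sum (@CF_fil _ _ _ R Y Z)
      (fun i : seq nat * fo_idx => contrib p i.1 (fo_disc i.2) (fo_count i.2)) (mu p);
  mu_lin : forall R (Y Y1 Y2 Z : robj F R) (p : cpath (CFo R) Y Y1)
      (q : cpath (CFo R) Y2 Z) (r : R) (a b : CF R Y1 Y2),
    mu (pcat (psnoc p (r *: a + b)) q) =
      r *: mu (pcat (psnoc p a) q) + mu (pcat (psnoc p b) q);
  mu_deg : forall R (Y Z : robj F R) (p : cpath (dE (CFo R)) Y Z),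
    hword p -> homog (odd (sdeg p)) (mu (vals p));
  mu_ainf : forall R (Y Z : robj F R) (p : cpath (dE (CFo R)) Y Z), hword p ->
    \sum_(s <- splits p) \sum_(t <- splits (sp_snd s))
      (-1) ^+ sdeg (sp_fst s) *:
      mu (pcat (psnoc (vals (sp_fst s)) (mu (vals (sp_fst t)))) (vals (sp_snd t)))
    = 0;
  unit_deg : forall R (Y : robj F R), homog false (unit_cf Y);
  unit_mu1 : forall R (Y : robj F R), mu (word1 (unit_cf Y)) = 0;
  unit_mu2r : forall R (Y Z : robj F R) (a : CF R Y Z),
    mu (word2 (unit_cf Y) a) = a;
  unit_mu2l : forall R (Y Z : robj F R) d (a : CF R Y Z), homog d a ->
    mu (word2 a (unit_cf Z)) = (-1) ^+ d *: a;
  unit_mu3 : forall R (Y Y1 Z : robj F R) (p : cpath (CFo R) Y Y1) (q : cpath (CFo R) Y1 Z),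
    (2 <= plen p + plen q)%N -> mu (pcat (psnoc (E := CFo R) p (unit_cf Y1)) q) = 0 }.

Section BaseChange.
Variables (Fo : foundations) (R : cfalg K).
Local Notation Lam := (nov_cfalg K).

Lemma CF_filP S L0 L1 : is_filtration (@CF_fil _ _ F S L0 L1).
Proof.
split.
- by move=> s i; rewrite ffunE; apply: (fil0 (ca_filP S)).
- by move=> s a b ha hb i; rewrite !ffunE; apply: (filB (ca_filP S)).
- by move=> s t st a ha i; apply: (fil_decr (ca_filP S) st).
- move=> a; pose f i := sval (cid (fil_exh (ca_filP S) (a i))).
  exists (\big[Num.min/0]_(i <- enum {: seq_sub (fd_gens L0 L1)}) f i) => i.
  have fi : ca_fil (f i) (a i) by rewrite /f; case: cid.
  apply: (fil_decr (ca_filP S)) fi.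
  have: i \in enum {: seq_sub (fd_gens L0 L1)} by rewrite mem_enum.
  elim: (enum _) => // j l IH; rewrite inE big_cons => /orP[/eqP <-|/IH h].
    by rewrite ge_min lexx.
  by rewrite ge_min h orbT.
- move=> a ha; apply/ffunP => i; rewrite ffunE; apply: (fil_sep (ca_filP S)) => s.
  exact: ha.
Qed.

Lemma is_sum_uniq (A : zmodType) (G : K -> set A) (I : choiceType) (t : I -> A) a b :
  is_filtration G -> is_sum G t a -> is_sum G t b -> a = b.
Proof.
move=> GP ha hb; apply/eqP; rewrite -subr_eq0; apply/eqP/(fil_sep GP) => s.
have [S1 _ h1] := ha s; have [S2 _ h2] := hb s.
pose S := undup (S1 ++ S2).
have -> : a - b = (a - \sum_(i <- S) t i) - (b - \sum_(i <- S) t i).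
  by rewrite opprB addrA subrK.
apply: (filB GP); [apply: h1|apply: h2]; rewrite ?undup_uniq// => i iS;
  by rewrite mem_undup mem_cat iS ?orbT.
Qed.

Definition bc_word (Y Z : robj F Lam) (p : cpath (CFo Lam) Y Z) :
    cpath (CFo R) (ro_bc R Y) (ro_bc R Z) :=
  pmap (f := ro_bc R) (E' := CFo R) (fun Y Z a => CF_bc R a) p.

Let bcl (e : (fd_gen F -> Lam) * robj F Lam) : (fd_gen F -> R) * robj F R :=
  (fun g => (e.1 g : novikov K)%:A, ro_bc R e.2).

Lemma scalA_M (x y : novikov K) : x%:A * y%:A = (x * y)%:A :> R.
Proof. by rewrite -scalerAl mul1r scalerA. Qed.

Lemma coef_bc (L0 L1 : Br) (a : CF Lam L0 L1) :
  coef (CF_bc R a) = fun g => (coef a g : novikov K)%:A.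
Proof.
apply/funext => g; rewrite /coef; case: insub => [i|]; first by rewrite ffunE.
by rewrite scale0r.
Qed.

Lemma flat_bc Y Z (p : cpath (CFo Lam) Y Z) : flat (bc_word p) = map bcl (flat p).
Proof.
elim: p => //= y z p -> a; rewrite map_rcons; congr rcons.
by rewrite /bcl /= coef_bc.
Qed.

Lemma insert_b_bc ns Y w : insert_b ns (ro_bc R Y) (map bcl w) = map bcl (insert_b ns Y w).
Proof.
elim: w ns Y => [|[a Z] w IH] ns Y /=; rewrite map_cat map_nseq /bcl /= coef_bc//.
by rewrite -IH.
Qed.

Lemma weight_bc arc i Y w ins :
  weight arc i (ro_bc R Y) (map bcl w) ins = (weight arc i Y w ins : novikov K)%:A.
Proof.
elim: w i Y ins => [|[a Z] w IH] i Y [|[g L] ins] //=; rewrite ?scale0r//.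
case: asboolP => _; rewrite ?scale0r// IH.
by rewrite !scalA_M.
Qed.

Lemma plen_bc Y Z (p : cpath (CFo Lam) Y Z) : plen (bc_word p) = plen p.
Proof. by elim: p => //= y z p ->. Qed.

Lemma contrib_bc Y Z (p : cpath (CFo Lam) Y Z) ns u n :
  contrib (bc_word p) ns u n = CF_bc R (contrib p ns u n).
Proof.
apply/ffunP => g; rewrite !ffunE plen_bc /=; case: ifP => _; last by rewrite scale0r.
by rewrite flat_bc insert_b_bc weight_bc scalerA.
Qed.

Lemma CF_bc_lin (L0 L1 : Br) (r : Lam) (a b : CF Lam L0 L1) :
  CF_bc R (r *: a + b) = (r : novikov K)%:A *: CF_bc R a + CF_bc R b.
Proof.
apply/ffunP => i; rewrite !ffunE scalerDl; congr (_ + _).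
by rewrite [RHS]scalA_M.
Qed.

Lemma CF_bc0 (L0 L1 : Br) : CF_bc R (0 : CF Lam L0 L1) = 0.
Proof. by apply/ffunP => i; rewrite !ffunE scale0r. Qed.

Lemma CF_bcB (L0 L1 : Br) (a b : CF Lam L0 L1) : CF_bc R (a - b) = CF_bc R a - CF_bc R b.
Proof. by apply/ffunP => i; rewrite !ffunE scalerBl. Qed.

Lemma CF_bc_sum (L0 L1 : Br) I (l : seq I) (f : I -> CF Lam L0 L1) :
  CF_bc R (\sum_(i <- l) f i) = \sum_(i <- l) CF_bc R (f i).
Proof.
elim: l => [|i l IH]; first by rewrite !big_nil CF_bc0.
by rewrite !big_cons -IH; apply/ffunP => j; rewrite !ffunE scalerDl.
Qed.

Lemma mu_bc Y Z (p : cpath (CFo Lam) Y Z) : mu Fo (bc_word p) = CF_bc R (mu Fo p).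
Proof.
apply: (is_sum_uniq (CF_filP R Y Z) (mu_count Fo (bc_word p))) => s.
have [S uS h] := mu_count Fo p s; exists S => // S' uS' SS' i.
have -> : \sum_(j <- S') contrib (bc_word p) j.1 (fo_disc j.2) (fo_count j.2) =
  CF_bc R (\sum_(j <- S') contrib p j.1 (fo_disc j.2) (fo_count j.2)).
  by rewrite CF_bc_sum; apply: eq_bigr => j _; rewrite contrib_bc.
by rewrite -CF_bcB ffunE; apply: ca_filA; apply: h.
Qed.

Lemma mu_lin1 (S : cfalg K) (Y Z : robj F S) (r : S) (a b : CF S Y Z) :
  mu Fo (word1 (r *: a + b)) = r *: mu Fo (word1 a) + mu Fo (word1 b).
Proof. exact: (@mu_lin Fo S Y Y Z Z pnil pnil). Qed.

Lemma mu_lin2r (S : cfalg K) (Y Z W : robj F S) (c : CF S Z W) (r : S) (a b : CF S Y Z) :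
  mu Fo (word2 (r *: a + b) c) = r *: mu Fo (word2 a c) + mu Fo (word2 b c).
Proof. exact: (@mu_lin Fo S Y Y Z W pnil (word1 c)). Qed.

Lemma mu_lin2l (S : cfalg K) (Y Z W : robj F S) (c : CF S Y Z) (r : S) (a b : CF S Z W) :
  mu Fo (word2 c (r *: a + b)) = r *: mu Fo (word2 c a) + mu Fo (word2 c b).
Proof. exact: (@mu_lin Fo S Y Z W W (word1 c) pnil). Qed.

Lemma mu_word2_bc (Y Z W : robj F Lam) (a : CF Lam Y Z) (c : CF Lam Z W) :
  mu Fo (word2 (CF_bc R a : CF R (ro_bc R Y) (ro_bc R Z)) (CF_bc R c : CF R (ro_bc R Z) (ro_bc R W)))
  = CF_bc R (mu Fo (word2 a c)).
Proof. exact: (mu_bc (word2 a c)). Qed.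

Lemma CF_basis (S : cfalg K) (L0 L1 : Br) (a : CF S L0 L1) :
  a = \sum_i a i *: [ffun j => (i == j)%:R : S^o].
Proof.
apply/ffunP => j; rewrite sum_ffunE (bigD1 j)//= !ffunE eqxx big1 ?addr0.
  by rewrite [RHS]mulr1.
by move=> i ij; rewrite !ffunE (negbTE ij) scaler0.
Qed.

Lemma CF_basis_bc (L0 L1 : Br) (i : seq_sub (fd_gens L0 L1)) :
  [ffun j => (i == j)%:R : R^o] =
  CF_bc R ([ffun j => (i == j)%:R : Lam^o] : CF Lam L0 L1).
Proof. by apply/ffunP => j; rewrite !ffunE scaler_nat. Qed.

Lemma mu_word2_0 (S : cfalg K) (Y Z W : robj F S) (c : CF S Y Z) :
  mu Fo (word2 c (0 : CF S Z W)) = 0.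
Proof.
have := mu_lin2l c (-1) (0 : CF S Z W) 0; rewrite scaler0 addr0 => ->.
by rewrite scaleN1r addNr.
Qed.

Lemma mu_word2_sum (S : cfalg K) (Y Z W : robj F S) (c : CF S Y Z) I (l : seq I)
    (r : I -> S) (f : I -> CF S Z W) :
  mu Fo (word2 c (\sum_(i <- l) r i *: f i)) = \sum_(i <- l) r i *: mu Fo (word2 c (f i)).
Proof.
elim: l => [|i l IH]; first by rewrite !big_nil mu_word2_0.
by rewrite !big_cons mu_lin2l IH.
Qed.

Lemma unit_bc (Y : robj F Lam) : unit_cf Fo (ro_bc R Y) = CF_bc R (unit_cf Fo Y).
Proof.
pose Y' := ro_bc R Y; pose e : CF R Y' Y' := CF_bc R (unit_cf Fo Y).
have e0 : homog false e by apply: homog_bc; apply: unit_deg.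
rewrite -/e -[RHS](scale1r e) -[1](expr0 (-1)) -(@unit_mu2l Fo R Y' Y' false e e0).
rewrite [X in word2 _ X]CF_basis mu_word2_sum [LHS]CF_basis; apply: eq_bigr => i _.
congr (_ *: _); rewrite CF_basis_bc (mu_word2_bc (unit_cf Fo Y)).
by rewrite unit_mu2r.
Qed.
End BaseChange.
End Operations.

Arguments CFo {K X F} R Y Z.

Section MatrixFactorisations.
Variable R : comNzRingType.

Definition mhomog (I : finType) (par : I -> bool) (d : bool) (v : {ffun I -> R^o}) :=
  forall i, par i != d -> v i = 0.

(* Z/2-graded free modules of finite rank, with a homogeneous basis *)
Record mf (w : R) := MF {
  mf_idx : finType;
  mf_par : mf_idx -> bool;
  mf_mod := {ffun mf_idx -> R^o};
  mf_d : mf_mod -> mf_mod;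
  mf_dlin : linear mf_d;
  mf_dodd : forall d v, mhomog mf_par d v -> mhomog mf_par (~~ d) (mf_d v);
  mf_dsq : forall v, mf_d (mf_d v) = w *: v }.

Definition in_degree w (M : mf w) (n : nat) (x : mf_mod M) : Prop :=
  mhomog (@mf_par w M) (odd n) x.

(* mu^1 and mu^2 on homogeneous morphisms f, of degree n *)
Definition mf_mu1 w (M N : mf w) (n : nat) (f : mf_mod M -> mf_mod N) :
    mf_mod M -> mf_mod N :=
  fun x => (-1) ^+ n *: (mf_d (f x) - (-1) ^+ n *: f (mf_d x)).

Definition mf_mu2 w (M N P : mf w) (g : mf_mod N -> mf_mod P) (n : nat)
    (f : mf_mod M -> mf_mod N) : mf_mod M -> mf_mod P :=
  fun x => (-1) ^+ n *: g (f x).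
End MatrixFactorisations.

Section Theta.
Variables (K : realType) (X : symplectic K) (F : floer_data X) (Fo : foundations F).
Local Notation Lam := (nov_cfalg K).

Definition curvature (R : cfalg K) (Y : robj F R) (w : R) : Prop :=
  mu Fo (pnil : cpath (CFo R) Y Y) = w *: unit_cf Fo Y.

(* objects of the Fukaya category over Lambda with curvature lam *)
Record fuk (lam : Lam) := Fuk {
  fk_obj :> robj F Lam;
  fk_curv : curvature fk_obj lam }.

Definition CFk (lam : Lam) (A B : fuk lam) := CF Lam A B.
Arguments CFk : clear implicits.

Definition fk_word lam (A B : fuk lam) (p : cpath (CFk lam) A B) : cpath (CFo Lam) A B :=
  pmap (f := @fk_obj lam) (E' := CFo Lam) (fun _ _ a => a) p.

Definition mu_fuk lam (A B : fuk lam) (p : cpath (CFk lam) A B) : CFk lam A B :=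
  mu Fo (fk_word p).

Definition homogk lam (A B : fuk lam) (a : dE (CFk lam) A B) : Prop := homog a.1 a.2.

Section Mirror.
Variables (R : cfalg K) (lam : Lam) (LL : robj F R) (W : R).
Hypothesis LLW : curvature LL W.

Let w : R := W - (lam : novikov K)%:A.
Local Notation A := (CF R LL LL).

Lemma koszul_lin (L0 L1 : brane (fd_dec F)) : linear (@koszul _ _ F R L0 L1).
Proof.
move=> r a b; apply/ffunP => i; rewrite !ffunE scalerDr; congr (_ + _).
by rewrite !scalerA mulrC.
Qed.

Lemma koszul_homog (L0 L1 : brane (fd_dec F)) d (a : CF R L0 L1) :
  homog d a -> koszul a = (-1) ^+ d *: a.
Proof.
move=> h; apply/ffunP => i; rewrite !ffunE.
by have [->//|/h ->] := eqVneq (fd_parity L0 L1 (ssval i)) d; rewrite !scaler0.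
Qed.

(* d x = (-1)^|x| mu^1(x) *)
Definition LM_d (B : fuk lam) (x : CF R LL (ro_bc R B)) : CF R LL (ro_bc R B) :=
  mu Fo (word1 (koszul x)).

Lemma LM_dlin (B : fuk lam) : linear (@LM_d B).
Proof. by move=> r a b; rewrite /LM_d koszul_lin mu_lin1. Qed.

Lemma LM_dodd (B : fuk lam) d (x : CF R LL (ro_bc R B)) : homog d x -> homog (~~ d) (LM_d x).
Proof.
move=> h; rewrite /LM_d (koszul_homog h).
rewrite (_ : word1 _ = vals (psnoc (E := dE (CFo R)) pnil (d, (-1) ^+ d *: x)))//.
rewrite (_ : ~~ d = odd (sdeg (psnoc (E := dE (CFo R)) pnil (d, (-1) ^+ d *: x)))); last first.
  by rewrite /= oddb.
apply: mu_deg; split => // i hi /=.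
by rewrite ffunE h// scaler0.
Qed.

Lemma homog_scale (L0 L1 : brane (fd_dec F)) d (r : R) (a : CF R L0 L1) :
  homog d a -> homog d (r *: a).
Proof. by move=> h i hi; rewrite ffunE h// scaler0. Qed.

Lemma mu_word1Z (Y Z : robj F R) (r : R) (a : CF R Y Z) :
  mu Fo (word1 (r *: a)) = r *: mu Fo (word1 a).
Proof.
have m0 : mu Fo (word1 (0 : CF R Y Z)) = 0.
  have := mu_lin1 Fo (-1) (0 : CF R Y Z) 0; rewrite scaler0 addr0 => ->.
  by rewrite scaleN1r addNr.
by rewrite -[r *: a]addr0 mu_lin1 m0 addr0.
Qed.

Lemma curvature_bc (B : fuk lam) : curvature (ro_bc R B) ((lam : novikov K)%:A : R).
Proof.
rewrite /curvature unit_bc.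
have -> : mu Fo (pnil : cpath (CFo R) (ro_bc R B) (ro_bc R B)) =
    CF_bc R (mu Fo (pnil : cpath (CFo Lam) B B)).
  exact: (mu_bc Fo R (pnil : cpath (CFo Lam) B B)).
rewrite fk_curv; apply/ffunP => i; rewrite !ffunE.
by rewrite [RHS]scalA_M.
Qed.

Lemma mu_word2Zr (Y1 Y2 Y3 : robj F R) (r : R) (a : CF R Y1 Y2) (c : CF R Y2 Y3) :
  mu Fo (word2 (r *: a) c) = r *: mu Fo (word2 a c).
Proof.
have m0 : mu Fo (word2 (0 : CF R Y1 Y2) c) = 0.
  have := mu_lin2r Fo c (-1) (0 : CF R Y1 Y2) 0; rewrite scaler0 addr0 => ->.
  by rewrite scaleN1r addNr.
by rewrite -[r *: a]addr0 mu_lin2r m0 addr0.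
Qed.

Lemma mu_word2Zl (Y1 Y2 Y3 : robj F R) (r : R) (a : CF R Y1 Y2) (c : CF R Y2 Y3) :
  mu Fo (word2 a (r *: c)) = r *: mu Fo (word2 a c).
Proof. by rewrite -[r *: c]addr0 mu_lin2l mu_word2_0 addr0. Qed.

Lemma mu1_sq (B : fuk lam) d (x : CF R LL (ro_bc R B)) : homog d x ->
  mu Fo (word1 (mu Fo (word1 x))) = - (w *: x).
Proof.
move=> h; have := @mu_ainf _ _ _ Fo R LL (ro_bc R B) (psnoc (E := dE (CFo R)) pnil (d, x)).
move=> /(_ (conj I h)) /=.
rewrite !(big_cons, big_nil, big_rcons, big_map) /= !addr0 expr0 add0n !scale1r => E.
have {E} : mu Fo (word2 (mu Fo (pnil : cpath (CFo R) LL LL)) x) +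
    mu Fo (word1 (mu Fo (word1 x))) + (-1) ^+ d.+1 *:
    mu Fo (word2 x (mu Fo (pnil : cpath (CFo R) (ro_bc R B) (ro_bc R B)))) = 0 by exact: E.
rewrite LLW curvature_bc mu_word2Zr mu_word2Zl unit_mu2r (unit_mu2l Fo h).
have -> : (-1) ^+ d.+1 *: ((lam : novikov K)%:A *: ((-1) ^+ d *: x)) = - ((lam : novikov K)%:A *: x).
  rewrite !scalerA mulrAC -exprD addSn addnn -mul2n exprS exprM sqrrN !expr1n.
  by rewrite mulr1 mulN1r scaleNr.
by rewrite addrAC addrC => /eqP; rewrite addr_eq0 -scalerBl => /eqP.
Qed.

Lemma LM_dsq (B : fuk lam) (x : CF R LL (ro_bc R B)) : LM_d (LM_d x) = w *: x.
Proof.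
have hom d y : homog d y -> LM_d (LM_d y) = w *: y :> CF R LL (ro_bc R B).
  move=> h; rewrite {1}/LM_d (koszul_homog (LM_dodd h)) /LM_d (koszul_homog h).
  rewrite !mu_word1Z (mu1_sq h) scalerA -exprD scalerN.
  by case: d {h}; rewrite /= ?expr1 ?expr0 ?scaleN1r ?opprK// add0n expr1 scaleN1r opprK.
pose part d : CF R LL (ro_bc R B) :=
  [ffun i => if fd_parity LL (ro_bc R B) (ssval i) == d then x i else 0].
have partP d : homog d (part d) by move=> i /negbTE hi; rewrite ffunE hi.
have -> : x = 1 *: part false + part true.
  apply/ffunP => i; rewrite !ffunE scale1r.
  by case: (fd_parity _ _ _); rewrite /= ?addr0 ?add0r.
by rewrite !LM_dlin !(hom _ _ (partP _)) !scalerDr !scale1r.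
Qed.

Definition LM (B : fuk lam) : mf w := @MF R w _
  (fun i => fd_parity LL (ro_bc R B) (ssval i)) (@LM_d B)
  (@LM_dlin B) (@LM_dodd B) (@LM_dsq B).
End Mirror.
End Theta.

Section Lifts.
Variables (K : realType) (X : symplectic K) (F : floer_data X).
Local Notation Lam := (nov_cfalg K).

Record augmentation (R : cfalg K) := Augmentation {
  aug :> {lrmorphism R -> Lam};
  aug_fil : forall s r, ca_fil s r -> ca_fil s (aug r) }.

(* reduction modulo the kernel of eps is application of eps *)
Record is_lift (R : cfalg K) (eps : augmentation R) (L : robj F Lam) (LL : robj F R) :
    Prop := {
  lift_brane : ro_br LL = ro_br L;
  lift_ls : forall c, is_path (lag_set L) c -> eps (ro_ls LL c) = ro_ls L c;
  lift_b : forall g, eps (coef (ro_b LL) g) = coef (ro_b L) g }.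
End Lifts.

Section Theta.
Variables (K : realType) (X : symplectic K) (F : floer_data X) (Fo : foundations F).
Local Notation Lam := (nov_cfalg K).
Variables (R : cfalg K) (lam : Lam) (LL : robj F R) (W : R) (LLW : curvature Fo LL W).
Local Notation fk := (fuk Fo lam).
Local Notation LM := (@LM _ _ _ Fo R lam LL W LLW).
Local Notation A := (CF R LL LL).
Local Notation CFk := (@CFk _ _ _ Fo lam).

Definition fk_bc (B C : fk) (p : cpath CFk B C) : cpath (CFo R) (ro_bc R B) (ro_bc R C) :=
  bc_word R (fk_word p).

(* LM^k for nonempty p; the sign (-1)^|x| is carried by koszul *)
Definition LM_map (B C : fk) (p : cpath CFk B C) (x : mf_mod (LM B)) : mf_mod (LM C) :=
  mu Fo (pcat (word1 (koszul x : CF R LL (ro_bc R B))) (fk_bc p)).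

(* Pre-natural endomorphisms of LM: multilinear over Lambda in the word, with values
   in R-linear maps. *)
Record cochain := Cochain {
  cc_map :> forall B C : fk, cpath CFk B C -> mf_mod (LM B) -> mf_mod (LM C);
  cc_linear : forall B C (p : cpath CFk B C), linear (cc_map p);
  cc_multi : forall B C1 C2 C (p : cpath CFk B C1) (q : cpath CFk C2 C) (r : Lam)
      (a b : CFk C1 C2) x,
    cc_map (pcat (psnoc p (r *: a + b)) q) x =
      ((r : novikov K)%:A : R) *: cc_map (pcat (psnoc p a) q) x
        + cc_map (pcat (psnoc p b) q) x }.

Definition hwordk (B C : fk) (p : cpath (dE CFk) B C) : Prop :=
  all_letters (@homogk _ _ _ Fo lam) p.

(* Degrees are natural numbers taken modulo 2, so that |phi| - 1 is n.+1. *)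
Definition cc_degree (n : nat) (phi : cochain) : Prop :=
  forall B C (p : cpath (dE CFk) B C) m (x : mf_mod (LM B)),
  hwordk p -> in_degree m x -> in_degree (n + sdeg p + m) (phi _ _ (vals p) x).

(* mu^1(phi) for phi of degree n, evaluated on a homogeneous word *)
Definition cc_mu1 (n : nat) (phi : cochain) B C (p : cpath (dE CFk) B C)
    (x : mf_mod (LM B)) : mf_mod (LM C) :=
  mf_mu1 (n + sdeg p) (phi _ _ (vals p)) x
  + \sum_(s <- splits p | (0 < plen (sp_snd s))%N)
      mf_mu2 (LM_map (vals (sp_snd s)))
             (n + sdeg (sp_fst s)) (phi _ _ (vals (sp_fst s))) x
  + \sum_(s <- splits p | (0 < plen (sp_fst s))%N)
      (-1) ^+ (n.+1 * sdeg (sp_fst s)) *: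
      mf_mu2 (phi _ _ (vals (sp_snd s)))
             (sdeg (sp_fst s)).+1 (LM_map (vals (sp_fst s))) x
  + \sum_(s <- splits p) \sum_(t <- splits (sp_snd s) | (0 < plen (sp_fst t))%N)
      (-1) ^+ (n + sdeg (sp_fst s)) *:
      phi _ _ (pcat (psnoc (vals (sp_fst s)) (mu_fuk (vals (sp_fst t))))
                    (vals (sp_snd t))) x.

(* mu^2(psi, phi) for psi, phi of degrees m, n *)
Definition cc_mu2 (m : nat) (psi : cochain) (n : nat) (phi : cochain) B C
    (p : cpath (dE CFk) B C) (x : mf_mod (LM B)) : mf_mod (LM C) :=
  \sum_(s <- splits p)
    (-1) ^+ (m.+1 * sdeg (sp_fst s)) *:
    mf_mu2 (psi _ _ (vals (sp_snd s)))
           (n + sdeg (sp_fst s)) (phi _ _ (vals (sp_fst s))) x.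

Definition cc_one B C (p : cpath (dE CFk) B C) : mf_mod (LM B) -> mf_mod (LM C) :=
  match p in cpath _ _ C return mf_mod (LM B) -> mf_mod (LM C) with
  | pnil => id
  | psnoc _ _ _ _ => fun=> 0
  end.

(* [:: c_1; ...; c_l], with declared degrees *)
Local Notation letters := (seq (bool * A)).

Definition hletters (cs : letters) : Prop := forall c, c \in cs -> homog c.1 c.2.

Definition box (cs : letters) : nat := \sum_(c <- cs) c.1.+1.

Fixpoint tri (cs : letters) : nat :=
  if cs is c :: cs' then (c.1.+1 * box cs' + tri cs')%N else 0%N.

(* the word in which the input c_l comes first and c_1 last *)
Fixpoint cword (cs : seq A) : cpath (CFo R) LL LL :=
  if cs is c :: cs' then psnoc (E := CFo R) (cword cs') c else pnil.

Definition mu_op (cs : letters) : A :=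
  (-1) ^+ (tri cs + (size cs).+1) *: mu Fo (cword (unzip2 cs)).

(* |c_1| + ... + |c_l| + 1 - l *)
Definition theta_degree (cs : letters) : nat := (box cs).+1.

Definition theta_sign (cs : letters) (dx : bool) : nat :=
  (box cs).+1 * dx.+1 + tri cs + (size cs).+1.

Definition theta_word (cs : seq A) B C (p : cpath CFk B C) (x : CF R LL (ro_bc R B)) :
    cpath (CFo R) LL (ro_bc R C) :=
  pcat (psnoc (E := CFo R) (cword cs) x) (fk_bc p).

Variable Theta : seq A -> cochain.

Definition theta_counts_discs : Prop :=
  forall (cs : letters) B C (p : cpath CFk B C) dx (x : CF R LL (ro_bc R B)),
  (0 < size cs)%N -> hletters cs -> homog dx x ->
  is_sum (@CF_fil _ _ F R LL (ro_bc R C))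
    (fun i : seq nat * fo_idx Fo => (-1) ^+ theta_sign cs dx *:
      contrib (theta_word (unzip2 cs) p x) i.1 (fo_disc i.2) (fo_count i.2))
    (Theta (unzip2 cs) _ _ p x).

Definition theta_multilinear : Prop :=
  forall (s t : seq A) (r : R) (a b : A) B C (p : cpath CFk B C) x,
  Theta (s ++ (r *: a + b) :: t) _ _ p x =
    r *: Theta (s ++ a :: t) _ _ p x + Theta (s ++ b :: t) _ _ p x.

Definition theta_graded : Prop :=
  forall cs : letters, (0 < size cs)%N -> hletters cs ->
  cc_degree (theta_degree cs) (Theta (unzip2 cs)).

Definition theta_ainf_hom : Prop :=
  forall (cs : letters) B C (p : cpath (dE CFk) B C) m (x : mf_mod (LM B)),
  (0 < size cs)%N -> hletters cs -> hwordk p -> in_degree m x ->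
  cc_mu1 (theta_degree cs) (Theta (unzip2 cs)) p x
  + \sum_(1 <= i < size cs)
      cc_mu2 (theta_degree (drop i cs)) (Theta (unzip2 (drop i cs)))
             (theta_degree (take i cs)) (Theta (unzip2 (take i cs))) p x
  = \sum_(0 <= i < size cs) \sum_(1 <= j < (size cs - i).+1)
      (-1) ^+ box (take i cs) *:
      Theta (unzip2 (take i cs) ++
             mu_op (take j (drop i cs)) :: unzip2 (drop (i + j) cs)) _ _ (vals p) x.

(* Theta^1(e) and the unit of CC, which is the identity in length zero, are
   cohomologous *)
Definition theta_cohomologically_unital : Prop :=
  exists eta : cochain, cc_degree 1 eta /\
  forall B C (p : cpath (dE CFk) B C) m (x : mf_mod (LM B)),
  hwordk p -> in_degree m x ->
  Theta [:: unit_cf Fo LL] _ _ (vals p) x = cc_one p x + cc_mu1 1 eta p x.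

(* T_B(c)(x), for c and x of degrees d and m *)
Definition module_action (B : fk) (d : nat) (c : A) (m : nat) (x : mf_mod (LM B)) :
    mf_mod (LM B) :=
  (-1) ^+ (d * m + d) *: mu Fo (word2 c (x : CF R LL (ro_bc R B))).

Definition theta_extends_module_action : Prop :=
  forall B : fk, exists h : A -> mf_mod (LM B) -> mf_mod (LM B),
  [/\ forall c, linear (h c),
      forall r a b x, h (r *: a + b) x = r *: h a x + h b x,
      forall d c m x, homog d c -> in_degree m x -> in_degree (d.+1 + m) (h c x)
    & forall (d : bool) c m x, homog d c -> in_degree m x ->
      Theta [:: c] _ _ (pnil : cpath CFk B B) x - module_action d c m x =
      mf_mu1 d.+1 (h c) x + h (mu_op [:: (d, c)]) x].
End Theta.

(* Main.v *)
(* The A_infinity-relation of mu_R for the word c_l, ..., c_1, x, a_1, ..., a_k has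
   three kinds of terms, according to whether the inner operation takes only c's, takes
   x, or takes only a's.  Up to the common sign (-1)^S with
   S = box * (|x| + 1) + tri + l + 1, they are respectively the terms of Theta applied to
   the opposite operations of the c's, minus those of the products and differentials
   in mf, and minus those of Theta applied to mu_F of the a's, so that the relation is
   the equation of an A_infinity-homomorphism; curvature insertions are multiples of
   strict units and vanish.  Strict unitality also gives Theta^1(e) = 1 on the nose, and
   the length zero part of Theta^1 is the module action itself, so that both homotopies
   can be taken to be zero. *)
Require Import Defs.
From mathcomp Require Import all_boot all_order all_algebra.
From mathcomp Require Import all_classical all_reals.
Set Implicit Arguments.
Unset Strict Implicit.
Unset Printing Implicit Defensive.
Import GRing.Theory.
Local Open Scope ring_scope.

(** Degrees are natural numbers read modulo 2; the sign comparisons below reduce to parities through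
    this. *)
Lemma signr_parity (R : pzRingType) m n : odd m = odd n -> (-1) ^+ m = (-1) ^+ n :> R.
Proof. by move=> h; rewrite -signr_odd h signr_odd. Qed.

Lemma mf_d0 (R : comNzRingType) (w : R) (M : mf w) : mf_d (0 : mf_mod M) = 0.
Proof.
have := mf_dlin (m := M) (-1) 0 0; rewrite scaler0 addr0 => ->.
by rewrite scaleN1r addNr.
Qed.

(** * Sums over the factorisations of a composable word *)

Section WordLemmas.
Variables (V : Type) (E : V -> V -> Type).

Lemma pcatA x y z t (p : cpath E x y) (q : cpath E y z) (r : cpath E z t) :
  pcat p (pcat q r) = pcat (pcat p q) r.
Proof. by elim: r p q => //= a b r IH e p q; rewrite IH. Qed.

Lemma plen_cat x y z (p : cpath E x y) (q : cpath E y z) :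
  plen (pcat p q) = (plen p + plen q)%N.
Proof. by elim: q p => [|a b q IH e] p /=; rewrite ?addn0// IH addnS. Qed.

Section Sums.
Variable A : zmodType.

Lemma sum_splits_rcons x y z (p : cpath E x y) (a : E y z) (G : split2 E x z -> A) :
  \sum_(s <- splits (psnoc p a)) G s =
    \sum_(s <- splits p) G (Split2 (sp_fst s) (psnoc (sp_snd s) a))
    + G (Split2 (psnoc p a) pnil).
Proof. by rewrite /= big_rcons big_map. Qed.

(** The cut falls either before or after the letter [a]. Applied with [a] the module input x, this
    separates the c's from the a's. *)
Lemma sum_splits_mid x y z t (p : cpath E x y) (a : E y z) (q : cpath E z t)
    (G : split2 E x t -> A) :
  \sum_(s <- splits (pcat (psnoc p a) q)) G s =
    \sum_(s <- splits p) G (Split2 (sp_fst s) (pcat (psnoc (sp_snd s) a) q))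
    + \sum_(s <- splits q) G (Split2 (pcat (psnoc p a) (sp_fst s)) (sp_snd s)).
Proof.
elim: q p a G => [|w t' q IH b] p a G.
  by rewrite sum_splits_rcons /= big_seq1.
by rewrite [LHS]sum_splits_rcons IH sum_splits_rcons addrA.
Qed.

(** Isolates the trivial factorisation. In the Hochschild differential it gives a term of the
    differential in mf, while the others give products with LM. *)
Lemma sum_splits_snd x z (p : cpath E x z) (G : split2 E x z -> A) :
  \sum_(s <- splits p) G s =
    G (Split2 p pnil) + \sum_(s <- splits p | (0 < plen (sp_snd s))%N) G s.
Proof.
case: z / p G => [|y z p a] G; first by rewrite !big_cons !big_nil.
rewrite sum_splits_rcons addrC; congr (_ + _).
by rewrite /= big_rcons /= big_map addr0.
Qed.

Lemma sum_splits_fst x z (p : cpath E x z) (G : split2 E x z -> A) :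
  \sum_(s <- splits p) G s =
    G (Split2 pnil p) + \sum_(s <- splits p | (0 < plen (sp_fst s))%N) G s.
Proof.
elim: p G => [|y z' p IH a] G; first by rewrite !big_cons !big_nil.
by rewrite sum_splits_rcons IH /= big_rcons /= big_map addrA.
Qed.
End Sums.

Lemma pmap_cat W (E' : W -> W -> Type) (f : V -> W) (h : forall x y, E x y -> E' (f x) (f y))
    x y z (p : cpath E x y) (q : cpath E y z) :
  Defs.pmap (E' := E') (f := f) h (pcat p q) = pcat (Defs.pmap h p) (Defs.pmap h q).
Proof. by elim: q p => //= a b q IH e p; rewrite IH. Qed.

Lemma vals_cat x y z (p : cpath (dE E) x y) (q : cpath (dE E) y z) :
  vals (pcat p q) = pcat (vals p) (vals q).
Proof. by elim: q p => //= a b q IH e p; rewrite IH. Qed.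

Lemma sdeg_cat x y z (p : cpath (dE E) x y) (q : cpath (dE E) y z) :
  sdeg (pcat p q) = (sdeg p + sdeg q)%N.
Proof. by elim: q p => [|a b q IH e] p /=; rewrite ?addn0// IH addnA. Qed.

Lemma all_letters_cat (P : forall x y, dE E x y -> Prop) x y z
    (p : cpath (dE E) x y) (q : cpath (dE E) y z) :
  all_letters P (pcat p q) <-> all_letters P p /\ all_letters P q.
Proof.
elim: q p => [|a b q IH e] p /=; first by split=> [|[]].
by rewrite IH; split=> [[[]]|[? []]].
Qed.

End WordLemmas.

Lemma sum_splits_pmap (A : zmodType) V (E : V -> V -> Type) W
    (E' : W -> W -> Type) (f : V -> W) (h : forall x y, E x y -> E' (f x) (f y))
    x z (p : cpath E x z) (G : split2 E' (f x) (f z) -> A) :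
  \sum_(s <- splits (Defs.pmap (E' := E') (f := f) h p)) G s =
  \sum_(s <- splits p) G (Split2 (Defs.pmap h (sp_fst s)) (Defs.pmap h (sp_snd s))).
Proof.
elim: p G => [|y z' p IH a] G; first by rewrite !big_cons !big_nil.
by rewrite [LHS](sum_splits_rcons (Defs.pmap h p) (h _ _ a)) IH sum_splits_rcons.
Qed.

(** Both sides run over the factorisations of [p] into three consecutive pieces, cutting off either
    the first or the last piece first. *)
Lemma sum_splits_assoc (A : zmodType) V (E : V -> V -> Type) x z (p : cpath E x z)
    (G : forall y1 y2, cpath E x y1 -> cpath E y1 y2 -> cpath E y2 z -> A) :
  \sum_(s <- splits p) \sum_(t <- splits (sp_snd s))
    G _ _ (sp_fst s) (sp_fst t) (sp_snd t) =
  \sum_(s <- splits p) \sum_(t <- splits (sp_fst s))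
    G _ _ (sp_fst t) (sp_snd t) (sp_snd s).
Proof.
elim: p G => [|y z' p IH a] G; first by rewrite !big_seq1.
rewrite !sum_splits_rcons /=; under eq_bigr do rewrite sum_splits_rcons /=.
rewrite big_split /= big_seq1 -addrA; congr (_ + _).
exact: (IH (fun y1 y2 p1 p2 p3 => G _ _ p1 p2 (psnoc p3 a))).
Qed.

(** Elements of [splits p] are not compared for equality; the equation
    [pcat (sp_fst s) (sp_snd s) = p] stands in for membership. It lets homogeneity of [p] pass to
    the pieces. *)
Lemma eq_sum_splits (A : zmodType) V (E : V -> V -> Type) x z (p : cpath E x z)
    (G H : split2 E x z -> A) :
  (forall s, pcat (sp_fst s) (sp_snd s) = p -> G s = H s) ->
  \sum_(s <- splits p) G s = \sum_(s <- splits p) H s.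
Proof.
elim: p G H => [|y z' p IH a] G H h; first by rewrite !big_seq1 h.
rewrite !sum_splits_rcons h//; congr (_ + _); apply: IH => s sp.
by apply: h => /=; rewrite sp.
Qed.

(** * Homogeneous components and multilinear extension *)

Section HomogeneousParts.
Variables (K : realType) (X : symplectic K) (F : floer_data X) (R : cfalg K).

Definition hpart (L0 L1 : brane (fd_dec F)) d (a : CF R L0 L1) : CF R L0 L1 :=
  [ffun i => if fd_parity L0 L1 (ssval i) == d then a i else 0].

Section Parts.
Variables L0 L1 : brane (fd_dec F).
Local Notation CF := (CF R L0 L1).

Lemma hpart_lin d : linear (hpart d : CF -> CF).
Proof.
move=> r a b; apply/ffunP => i; rewrite !ffunE.
by case: ifP; rewrite // scaler0 addr0.
Qed.

Lemma hpart_id d (a : CF) : homog d a -> hpart d a = a.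
Proof.
move=> h; apply/ffunP => i; rewrite ffunE.
by case: eqVneq => // /h.
Qed.

Lemma hpart_other d (a : CF) : homog d a -> hpart (~~ d) a = 0.
Proof.
move=> h; apply/ffunP => i; rewrite !ffunE.
by case: eqVneq => // e; rewrite h// e; case: (d).
Qed.

(* The multilinear extension of a function given on homogeneous letters. *)
Fixpoint hsum (V : zmodType) (f : seq (bool * CF) -> V) (cs : seq CF) : V :=
  if cs is c :: cs' then
    hsum (fun w => f ((false, hpart false c) :: w)) cs'
    + hsum (fun w => f ((true, hpart true c) :: w)) cs'
  else f [::].

Lemma hsum_lin (V : lmodType R) (f g h : seq (bool * CF) -> V) (r : R) cs :
  (forall w, f w = r *: g w + h w) -> hsum f cs = r *: hsum g cs + hsum h cs.
Proof.
elim: cs f g h => [|c cs IH] f g h e /=; first exact: e.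
by rewrite scalerDr addrACA; congr (_ + _); apply: IH => w; apply: e.
Qed.

Lemma hsum_multilinear (V : lmodType R) (f : seq (bool * CF) -> V) (r : R) :
  (forall w1 w2 d a b, f (w1 ++ (d, r *: a + b) :: w2) =
    r *: f (w1 ++ (d, a) :: w2) + f (w1 ++ (d, b) :: w2)) ->
  forall s t a b, hsum f (s ++ (r *: a + b) :: t) =
    r *: hsum f (s ++ a :: t) + hsum f (s ++ b :: t).
Proof.
move=> + s; elim: s f => [|c s IH] f fl t a b /=.
  rewrite !hpart_lin scalerDr addrACA; congr (_ + _); apply: hsum_lin => w.
    exact: (fl [::]).
  exact: (fl [::]).
rewrite scalerDr addrACA; congr (_ + _); apply: IH => w1 w2 d a' b'.
  exact: (fl (_ :: w1)).
exact: (fl (_ :: w1)).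
Qed.

(** Only the summand with the declared degrees survives: in every other one some letter is the part
    of the wrong parity, hence 0. *)
Lemma hsum_homog (V : zmodType) (f : seq (bool * CF) -> V) cs :
  (forall w1 w2 d, f (w1 ++ (d, 0) :: w2) = 0) ->
  (forall c, c \in cs -> homog c.1 c.2) -> hsum f (unzip2 cs) = f cs.
Proof.
have hsum0 (g : seq (bool * CF) -> V) s : (forall w, g w = 0) -> hsum g s = 0.
  by elim: s g => [|c s IH] g g0 //=; rewrite !IH ?addr0.
elim: cs f => //= -[d c] cs IH f f0 hcs /=.
have hc : homog d c by apply: (hcs (d, c)); rewrite mem_head.
have zero d' : hpart d' c = 0 ->
    hsum (fun w => f ((d', hpart d' c) :: w)) (unzip2 cs) = 0.
  by move=> e; apply: hsum0 => w; rewrite e; apply: (f0 [::]).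
have keep : hsum (fun w => f ((d, hpart d c) :: w)) (unzip2 cs) = f ((d, c) :: cs).
  rewrite (hpart_id hc) (IH (fun w => f ((d, c) :: w)))// => [w1 w2 d'|c' c'cs].
    exact: (f0 (_ :: w1)).
  by apply: hcs; rewrite inE c'cs orbT.
case: d hc keep {hcs} => hc keep.
  by rewrite (zero false) ?add0r// (hpart_other hc).
by rewrite (zero true) ?addr0// (hpart_other hc).
Qed.
End Parts.
End HomogeneousParts.

(** * Construction of Theta and its values on homogeneous inputs *)

Section Construction.
Variables (K : realType) (X : symplectic K) (F : floer_data X) (Fo : foundations F).
Local Notation Lam := (nov_cfalg K).
Variables (R : cfalg K) (lam : Lam) (LL : robj F R) (W : R) (LLW : curvature Fo LL W).
Local Notation fk := (fuk Fo lam).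
Local Notation LM := (@LM _ _ _ Fo R lam LL W LLW).
Local Notation A := (CF R LL LL).
Local Notation CFk := (@CFk _ _ _ Fo lam).
Local Notation letters := (seq (bool * A)).

Lemma mu_mid0 (Y Y1 Y2 Z : robj F R) (p : cpath (CFo R) Y Y1) (q : cpath (CFo R) Y2 Z) :
  mu Fo (pcat (psnoc (E := CFo R) p (0 : CF R Y1 Y2)) q) = 0.
Proof.
have := mu_lin Fo p q (-1) (0 : CF R Y1 Y2) 0; rewrite scaler0 addr0 => ->.
by rewrite scaleN1r addNr.
Qed.

Lemma mu_midZ (Y Y1 Y2 Z : robj F R) (p : cpath (CFo R) Y Y1) (q : cpath (CFo R) Y2 Z)
    (r : R) (a : CF R Y1 Y2) :
  mu Fo (pcat (psnoc (E := CFo R) p (r *: a)) q) = r *: mu Fo (pcat (psnoc (E := CFo R) p a) q).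
Proof. by rewrite -[r *: a]addr0 mu_lin mu_mid0 addr0. Qed.

Lemma cword_cat (s t : seq A) : cword (s ++ t) = pcat (cword t) (cword s).
Proof. by elim: s => //= c s ->. Qed.

Lemma theta_word_mid (s t : seq A) (c : A) (B C : fk) (p : cpath CFk B C) x :
  theta_word (s ++ c :: t) p x =
    pcat (psnoc (E := CFo R) (cword t) c) (theta_word s p x).
Proof. by rewrite /theta_word cword_cat /= pcatA. Qed.

Lemma fk_bc_cat (B C D : fk) (p : cpath CFk B C) (q : cpath CFk C D) :
  fk_bc R (pcat p q) = pcat (fk_bc R p) (fk_bc R q).
Proof. by rewrite /fk_bc /fk_word /bc_word !pmap_cat. Qed.

Lemma fk_bc_snoc (B C D : fk) (p : cpath CFk B C) (a : CFk C D) :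
  fk_bc R (psnoc p a) = psnoc (E := CFo R) (fk_bc R p)
    (CF_bc R a : CFo R (ro_bc R C) (ro_bc R D)).
Proof. by []. Qed.

(* [koszul] carries the factor (-1)^|x| of the sign [theta_sign]. *)
Definition theta_term (w : letters) (B C : fk) (p : cpath CFk B C)
    (x : CF R LL (ro_bc R B)) : CF R LL (ro_bc R C) :=
  (-1) ^+ ((box w).+1 + tri w + (size w).+1) *:
  mu Fo (theta_word (unzip2 w) p (if odd (box w) then x else koszul x)).

(** Signs see only the declared degrees, so a letter may be changed without changing them. This is
    what makes the signed terms linear in each letter. *)
Lemma box_mid (w1 w2 : letters) d (a b : A) :
  box (w1 ++ (d, a) :: w2) = box (w1 ++ (d, b) :: w2).
Proof. by rewrite /box !big_cat !big_cons. Qed.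

Lemma tri_mid (w1 w2 : letters) d (a b : A) :
  tri (w1 ++ (d, a) :: w2) = tri (w1 ++ (d, b) :: w2).
Proof. by elim: w1 => //= c w1 ->; rewrite (box_mid _ _ _ a b). Qed.

Lemma theta_term_multilinear (r : R) (w1 w2 : letters) d (a b : A)
    (B C : fk) (p : cpath CFk B C) x :
  theta_term (w1 ++ (d, r *: a + b) :: w2) p x =
    r *: theta_term (w1 ++ (d, a) :: w2) p x + theta_term (w1 ++ (d, b) :: w2) p x.
Proof.
(* The signs of all three words are rewritten to those of the word with letter 0, so that they
   coincide. *)
rewrite /theta_term (box_mid _ _ _ (r *: a + b) 0) (tri_mid _ _ _ (r *: a + b) 0).
rewrite (box_mid _ _ _ a 0) (tri_mid _ _ _ a 0) (box_mid _ _ _ b 0) (tri_mid _ _ _ b 0).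
rewrite /unzip2 !map_cat !size_cat /= !theta_word_mid mu_lin.
by rewrite scalerDr !scalerA mulrC.
Qed.

Lemma theta_term_linear (w : letters) (B C : fk) (p : cpath CFk B C) (r : R) x y :
  theta_term w p (r *: x + y) = r *: theta_term w p x + theta_term w p y.
Proof.
rewrite /theta_term.
have -> : (if odd (box w) then r *: x + y else koszul (r *: x + y)) =
    r *: (if odd (box w) then x else koszul x) + (if odd (box w) then y else koszul y).
  by case: ifP => // _; rewrite koszul_lin.
by rewrite mu_lin scalerDr !scalerA mulrC.
Qed.

Lemma theta_term_multi (w : letters) (B C1 C2 C : fk) (p : cpath CFk B C1)
    (q : cpath CFk C2 C) (r : Lam) (a b : CFk C1 C2) x :
  theta_term w (pcat (psnoc p (r *: a + b)) q) x =
    ((r : novikov K)%:A : R) *: theta_term w (pcat (psnoc p a) q) x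
      + theta_term w (pcat (psnoc p b) q) x.
Proof.
rewrite /theta_term /theta_word !fk_bc_cat /= !pcatA /= CF_bc_lin mu_lin.
by rewrite scalerDr !scalerA mulrC.
Qed.

(** The sign of a disc depends on the degrees of the c's, which bare letters do not carry; [hsum]
    supplies them by decomposing each letter into its two homogeneous parts. *)
Definition theta_fun (cs : seq A) (B C : fk) (p : cpath CFk B C)
    (x : CF R LL (ro_bc R B)) : CF R LL (ro_bc R C) :=
  hsum (fun w => theta_term w p x) cs.

Definition theta (cs : seq A) : cochain lam LLW.
Proof.
apply: (@Cochain _ _ _ _ _ _ _ _ _ (theta_fun cs)).
- move=> B C p r x y; apply: hsum_lin => w; exact: theta_term_linear.
- move=> B C1 C2 C p q r a b x; apply: hsum_lin => w; exact: theta_term_multi.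
Defined.

(** With [n = box w] this is the factor (box - 1)(|x| - 1) of the sign. For odd [n] it is trivial;
    for even [n] it is (-1)^(|x| - 1), and [koszul] provides its dependence on |x| while staying
    linear in x. *)
Lemma signr_koszul (L0 L1 : brane (fd_dec F)) n d (x : CF R L0 L1) : homog d x ->
  (-1) ^+ n.+1 *: (if odd n then x else koszul x) = (-1) ^+ (n.+1 * d.+1) *: x.
Proof.
move=> h; case: ifP => on.
  by congr (_ *: _); apply: signr_parity; rewrite oddM /= on.
rewrite (koszul_homog h) scalerA -exprD; congr (_ *: _); apply: signr_parity.
by rewrite oddM oddD /= on; case: d {h}.
Qed.

Lemma thetaE (cs : letters) (B C : fk) (p : cpath CFk B C) dx (x : CF R LL (ro_bc R B)) :
  hletters cs -> homog dx x ->
  theta_fun (unzip2 cs) p x =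
    (-1) ^+ theta_sign cs dx *: mu Fo (theta_word (unzip2 cs) p x).
Proof.
move=> hcs hx; rewrite /theta_fun hsum_homog//; last first.
  move=> w1 w2 d; have := theta_term_multilinear (-1) w1 w2 d 0 0 p x.
  by rewrite scaler0 addr0 => ->; rewrite scaleN1r addNr.
rewrite /theta_term /theta_word -addnA exprD mulrC -scalerA -mu_midZ.
by rewrite (signr_koszul _ hx) mu_midZ scalerA -exprD addnC /theta_sign -!addnA.
Qed.

(** * The relation for the word c_l, ..., c_1, x, a_1, ..., a_k with declared degrees *)

Fixpoint dcword (cs : letters) : cpath (dE (CFo R)) LL LL :=
  if cs is c :: cs' then psnoc (E := dE (CFo R)) (dcword cs') c else pnil.

Lemma vals_dcword cs : vals (dcword cs) = cword (unzip2 cs).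
Proof. by elim: cs => //= c cs ->. Qed.

Lemma sdeg_dcword cs : sdeg (dcword cs) = box cs.
Proof.
elim: cs => [|c cs IH]; first by rewrite /box big_nil.
by rewrite /box big_cons /= IH addnC.
Qed.

Lemma hword_dcword cs : hletters cs -> hword (dcword cs).
Proof.
elim: cs => //= c cs IH h; split; last by apply: h; rewrite mem_head.
by apply: IH => c' c'cs; apply: h; rewrite inE c'cs orbT.
Qed.

(** The word runs from c_l to c_1, so its initial pieces are the tails of the list. *)
Lemma sum_splits_dcword (V : zmodType) cs (G : split2 (dE (CFo R)) LL LL -> V) :
  \sum_(s <- splits (dcword cs)) G s =
  \sum_(0 <= i < (size cs).+1) G (Split2 (dcword (drop i cs)) (dcword (take i cs))).
Proof.
elim: cs G => [|c cs IH] G; first by rewrite /= big_seq1 big_nat1.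
by rewrite sum_splits_rcons IH [in RHS]big_nat_recl// addrC.
Qed.

Definition dbc (B C : fk) (p : cpath (dE CFk) B C) :
    cpath (dE (CFo R)) (ro_bc R B) (ro_bc R C) :=
  Defs.pmap (f := fun B : fk => ro_bc R B) (E' := dE (CFo R))
    (fun _ _ a => (a.1, CF_bc R a.2)) p.

Lemma sum_splits_dbc (V : zmodType) (B C : fk) (p : cpath (dE CFk) B C)
    (G : split2 (dE (CFo R)) (ro_bc R B) (ro_bc R C) -> V) :
  \sum_(s <- splits (dbc p)) G s =
  \sum_(s <- splits p) G (Split2 (dbc (sp_fst s)) (dbc (sp_snd s))).
Proof.
exact: (@sum_splits_pmap V fk (dE CFk) (robj F R) (dE (CFo R)) (fun B : fk => ro_bc R B)).
Qed.

Lemma vals_dbc (B C : fk) (p : cpath (dE CFk) B C) : vals (dbc p) = fk_bc R (vals p).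
Proof. by elim: p => //= C1 C2 p IH a; rewrite -/(dbc p) IH. Qed.

Lemma sdeg_dbc (B C : fk) (p : cpath (dE CFk) B C) : sdeg (dbc p) = sdeg p.
Proof. by elim: p => //= C1 C2 p IH a; rewrite -/(dbc p) IH. Qed.

Lemma hword_dbc (B C : fk) (p : cpath (dE CFk) B C) : hwordk p -> hword (dbc p).
Proof. by elim: p => //= C1 C2 p IH a [/IH hp ha]; split=> //; apply: homog_bc. Qed.

(** The operations of the Fukaya category are computed over Lambda, those inside Theta over [R];
    [mu_bc] identifies the two on words from Lambda. *)
Lemma fk_bc_mu (B C : fk) (p : cpath CFk B C) : CF_bc R (mu_fuk p) = mu Fo (fk_bc R p).
Proof. by rewrite /mu_fuk -mu_bc. Qed.

(** With degrees attached to c's, x and a's, the whole word is homogeneous and [mu_deg] applies; its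
    [sdeg] is the sum of the three contributions. *)
Lemma mu_theta_homog (cs : letters) (B C : fk) (p : cpath (dE CFk) B C) dx
    (x : CF R LL (ro_bc R B)) : hletters cs -> hwordk p -> homog dx x ->
  homog (odd (box cs + dx.+1 + sdeg p)) (mu Fo (theta_word (unzip2 cs) (vals p) x)).
Proof.
move=> hcs hp hx; rewrite /theta_word -vals_dbc -vals_dcword.
rewrite -[psnoc _ _]/(vals (psnoc (E := dE (CFo R)) (dcword cs) (dx, x))) -vals_cat.
rewrite -(sdeg_dbc p) -(sdeg_dcword cs) -[X in odd (X + _)]/(sdeg
  (psnoc (E := dE (CFo R)) (dcword cs) (dx, x))) -sdeg_cat.
apply: mu_deg; apply/all_letters_cat; split; last exact: hword_dbc.
by split; first exact: hword_dcword.
Qed.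

(** This is [mu_ainf] for the concatenated word, sorted by an inner operation that takes only c's,
    takes x, or takes only a's. The sign is the reduced degree of the letters preceding the inner
    operation; in the first two sums these are the tail of [cs]. *)
Lemma mu_ainf_theta (cs : letters) (B C : fk) (p : cpath (dE CFk) B C) dx
    (x : CF R LL (ro_bc R B)) : hletters cs -> hwordk p -> homog dx x ->
  \sum_(0 <= i < (size cs).+1) \sum_(0 <= j < (size cs - i).+1)
    (-1) ^+ box (drop (i + j) cs) *:
    mu Fo (theta_word (unzip2 (take i cs) ++ mu Fo (cword (unzip2 (take j (drop i cs))))
                       :: unzip2 (drop (i + j) cs)) (vals p) x)
  + \sum_(0 <= i < (size cs).+1) \sum_(t <- splits p)
    (-1) ^+ box (drop i cs) *:
    mu Fo (theta_word (unzip2 (drop i cs)) (vals (sp_snd t))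
      (mu Fo (theta_word (unzip2 (take i cs)) (vals (sp_fst t)) x)))
  + \sum_(s <- splits p) \sum_(t <- splits (sp_snd s))
    (-1) ^+ (box cs + dx.+1 + sdeg (sp_fst s)) *:
    mu Fo (theta_word (unzip2 cs)
      (pcat (psnoc (vals (sp_fst s)) (mu_fuk (vals (sp_fst t)))) (vals (sp_snd t))) x)
  = 0.
Proof.
move=> hcs hp hx; pose cw := dcword cs; pose q := dbc p.
have hw : hword (pcat (psnoc (E := dE (CFo R)) cw (dx, x)) q).
  apply/all_letters_cat; split; last exact: hword_dbc.
  by split; first exact: hword_dcword.
(* The first cut is placed relative to x. After x, the inner operation takes only a's; before x, the
   second cut is placed relative to x as well. *)
rewrite -[RHS](mu_ainf Fo hw) sum_splits_mid /=; congr (_ + _); last first.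
  rewrite [RHS]sum_splits_dbc; apply: eq_bigr => s _ /=.
  rewrite [RHS]sum_splits_dbc; apply: eq_bigr => t _ /=.
  rewrite sdeg_cat /= sdeg_dcword sdeg_dbc; congr (_ *: _).
  rewrite vals_cat /= vals_dcword !vals_dbc /theta_word.
  by rewrite fk_bc_cat fk_bc_snoc fk_bc_mu pcatA.
under [in RHS]eq_bigr do rewrite sum_splits_mid /=.
rewrite big_split /=; congr (_ + _); last first.
  rewrite [RHS]sum_splits_dcword; apply: eq_bigr => i _ /=.
  rewrite [RHS]sum_splits_dbc; apply: eq_bigr => t _ /=.
  rewrite sdeg_dcword; congr (_ *: _).
  by rewrite vals_cat /= !vals_dcword !vals_dbc.
(* Cuts off the piece next to x first, so that i counts the letters c_1, ..., c_i left outside there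
   and j those inside the inner operation. *)
rewrite [RHS](sum_splits_assoc cw (fun y1 y2 p1 p2 p3 => (-1) ^+ sdeg p1 *:
  mu Fo (pcat (psnoc (E := CFo R) (vals p1) (mu Fo (vals p2)))
    (vals (pcat (psnoc (E := dE (CFo R)) p3 (dx, x)) q))))).
rewrite [RHS]sum_splits_dcword; apply: eq_bigr => i _ /=.
rewrite [RHS]sum_splits_dcword size_drop; apply: eq_bigr => j _ /=.
rewrite drop_drop addnC sdeg_dcword; congr (_ *: _).
by rewrite theta_word_mid /theta_word vals_cat /= !vals_dcword vals_dbc.
Qed.

(** * Vanishing of curvature insertions *)

Lemma plen_cword (cs : seq A) : plen (cword cs) = size cs.
Proof. by elim: cs => //= c cs ->. Qed.

(** Together with x, one further c makes at least three inputs, and [unit_mu3] applies. *)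
Lemma mu_unit_letter (s t : seq A) (r : R) (B C : fk) (p : cpath CFk B C) x :
  (0 < size s + size t)%N ->
  mu Fo (theta_word (s ++ r *: unit_cf Fo LL :: t) p x) = 0.
Proof.
move=> st; rewrite theta_word_mid mu_midZ unit_mu3 ?scaler0//.
by rewrite /theta_word plen_cat /= !plen_cword addnA addnS addSn ltnS addn_gt0 addnC st.
Qed.

(** By base change the curvature of [D] over [R] is still [lam] times the unit; x and at least one c
    are the other inputs. *)
Lemma mu_unit_arc (cs : seq A) (B D C : fk) (p : cpath CFk B D) (q : cpath CFk D C) x :
  (0 < size cs)%N ->
  mu Fo (theta_word cs (pcat (psnoc p (mu_fuk (pnil : cpath CFk D D))) q) x) = 0.
Proof.
move=> cs0; rewrite /theta_word fk_bc_cat fk_bc_snoc fk_bc_mu.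
have -> : mu Fo (fk_bc R (pnil : cpath CFk D D)) =
    ((lam : novikov K)%:A : R) *: unit_cf Fo (ro_bc R D) := curvature_bc R D.
rewrite pcatA /= mu_midZ unit_mu3 ?scaler0// plen_cat /= plen_cword.
by rewrite -addnA addSn ltnS (leq_trans cs0)// leq_addr.
Qed.

(** * Comparison of the signs *)

Lemma box_cat (s t : letters) : box (s ++ t) = (box s + box t)%N.
Proof. by rewrite /box big_cat. Qed.

Lemma box_cons d c (s : letters) : box ((d, c) :: s) = (d.+1 + box s)%N.
Proof. by rewrite /box big_cons. Qed.

Lemma tri_cons d c (s : letters) : tri ((d, c) :: s) = (d.+1 * box s + tri s)%N.
Proof. by []. Qed.

Lemma tri_cat (s t : letters) : tri (s ++ t) = (tri s + tri t + box s * box t)%N.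
Proof.
elim: s => [|[d c] s IH]; first by rewrite /= /box big_nil mul0n addn0.
rewrite cat_cons !tri_cons IH box_cat box_cons; move: d.+1 => k.
rewrite mulnDl mulnDr -!addnA; congr (_ + _)%N; by rewrite addnCA; congr (_ + _)%N; rewrite addnCA.
Qed.

Lemma mu_op_homog (cs : letters) : hletters cs -> homog (odd (box cs)) (mu_op Fo cs).
Proof.
move=> hcs; apply: homog_scale; rewrite -vals_dcword -sdeg_dcword.
by apply: mu_deg; apply: hword_dcword.
Qed.

Lemma hletters_cat (s t : letters) : hletters s -> hletters t -> hletters (s ++ t).
Proof. by move=> hs ht c; rewrite mem_cat => /orP[/hs|/ht]. Qed.

(* The exponent S. *)
Definition theta_exp (cs : letters) (dx : bool) : nat :=
  box cs * dx.+1 + tri cs + (size cs).+1.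

(** Replacing [t] by [mu_op Fo t] shifts the total reduced degree by one, which turns the factor
    [(box cs).+1] of [theta_sign] into the [box cs] of [theta_exp]. *)
Lemma theta_mu_op (s t u : letters) (B C : fk) (p : cpath CFk B C) dx
    (x : CF R LL (ro_bc R B)) :
  hletters s -> hletters t -> hletters u -> homog dx x ->
  (-1) ^+ box s *: theta_fun (unzip2 s ++ mu_op Fo t :: unzip2 u) p x =
  (-1) ^+ theta_exp (s ++ t ++ u) dx *: ((-1) ^+ box u *:
    mu Fo (theta_word (unzip2 s ++ mu Fo (cword (unzip2 t)) :: unzip2 u) p x)).
Proof.
move=> hs ht hu hx.
have -> : unzip2 s ++ mu_op Fo t :: unzip2 u =
    unzip2 (s ++ (odd (box t), mu_op Fo t) :: u) by rewrite /unzip2 map_cat.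
rewrite (thetaE _ _ hx); last first.
  apply: hletters_cat => // c; rewrite inE => /orP[/eqP ->|/hu//].
  exact: mu_op_homog.
rewrite /unzip2 map_cat /= !theta_word_mid mu_midZ !scalerA -!exprD.
congr (_ *: _); apply: signr_parity.
rewrite /theta_sign /theta_exp !(tri_cat, tri_cons, box_cat, box_cons, size_cat) /size.
rewrite -!/(size _) !mulSn.
(* Both exponents depend only on the parities of these numbers, which leaves a finite case check. *)
move: (box s) (box t) (box u) (tri s) (tri t) (tri u) => bs bt bu ts tt tu.
move: (size s) (size t) (size u) (oddS dx) (oddS (odd bt)) => ls lt lu.
move: dx.+1 (odd bt).+1 => k1 k2 h1 h2.
rewrite !(oddD, oddM, oddS) h1 h2 !oddb.
move: (odd bs) (odd bt) (odd bu) dx {hx h1} => [] [] [] [] /=;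
  by move: (odd ts) (odd tt) (odd tu) (odd ls) (odd lt) (odd lu) => [] [] [] [] [] [].
Qed.

(** The degree of the inner value enters the sign of the outer Theta. There [sdeg p] occurs with
    coefficient [(box t).+1], which cancels against the two signs of the product of cochains. *)
Lemma theta_comp (s t : letters) (B D C : fk) (p : cpath (dE CFk) B D)
    (q : cpath (dE CFk) D C) dx (x : CF R LL (ro_bc R B)) :
  hletters s -> hletters t -> hwordk p -> homog dx x ->
  (-1) ^+ ((theta_degree t).+1 * sdeg p) *: ((-1) ^+ (theta_degree s + sdeg p) *:
    theta_fun (unzip2 t) (vals q) (theta_fun (unzip2 s) (vals p) x)) =
  (-1) ^+ (theta_exp (s ++ t) dx).+1 *: ((-1) ^+ box t *:
    mu Fo (theta_word (unzip2 t) (vals q) (mu Fo (theta_word (unzip2 s) (vals p) x)))).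
Proof.
move=> hs ht hp hx; have hy := mu_theta_homog hs hp hx.
rewrite (thetaE _ hs hx) (thetaE _ ht (homog_scale _ hy)) /theta_word mu_midZ.
rewrite !scalerA -!exprD; congr (_ *: _); apply: signr_parity.
rewrite /theta_degree /theta_sign /theta_exp !(tri_cat, box_cat, size_cat) !mulSn.
move: (sdeg p) (box s) (box t) (tri s) (tri t) (size s) (size t) (oddS dx) => e bs bt ts tt ls lt.
move: (oddS (odd (bs + dx.+1 + e))); move: (odd (bs + dx.+1 + e)).+1 => k2.
move: dx.+1 => k1 h2 h1.
rewrite !(oddD, oddM, oddS) h2 !(oddD, oddb) h1 !oddb.
move: (odd e) (odd bs) (odd bt) dx {hx hy h1} => [] [] [] [] /=;
  by move: (odd ts) (odd tt) (odd ls) (odd lt) => [] [] [] [].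
Qed.

(* So [theta_comp] also covers the terms involving LM: they are those with s or t empty. *)
Lemma theta_nil (B C : fk) (p : cpath CFk B C) (x : CF R LL (ro_bc R B)) :
  theta_fun [::] p x = mu Fo (pcat (word1 (koszul x)) (fk_bc R p)).
Proof.
rewrite /theta_fun /= /theta_term /box big_nil /=.
by rewrite addn1 expr2 mulrNN mulr1 scale1r.
Qed.

Lemma mf_dE (B : fk) (x : mf_mod (LM B)) :
  mf_d x = theta_fun [::] (pnil : cpath CFk B B) x.
Proof. by rewrite theta_nil. Qed.

Lemma LM_mapE (B C : fk) (p : cpath CFk B C) (x : mf_mod (LM B)) :
  LM_map p x = theta_fun [::] p x.
Proof. by rewrite theta_nil. Qed.

(** * The properties of Theta *)

Lemma theta_disc_counts : theta_counts_discs theta.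
Proof.
move=> cs B C p dx x _ hcs hx; rewrite [cc_map _ _ _]/= (thetaE p hcs hx) => s.
have [S uS h] := mu_count Fo (theta_word (unzip2 cs) p x) s.
exists S => // S' uS' SS'; rewrite -scaler_sumr -scalerBr => i; rewrite ffunE.
have hi := h S' uS' SS' i.
(* The sign is 1 or -1, and each filtration step is closed under opposites. *)
rewrite -signr_odd; case: (odd _); rewrite ?expr0 ?scale1r ?expr1 ?scaleN1r//.
rewrite -sub0r; apply: (filB (ca_filP R)) => //; exact: (fil0 (ca_filP R)).
Qed.

Lemma theta_is_multilinear : theta_multilinear theta.
Proof.
move=> s t r a b B C p x; apply: hsum_multilinear => w1 w2 d a' b'.
exact: theta_term_multilinear.
Qed.

Lemma theta_is_graded : theta_graded theta.
Proof.
move=> cs _ hcs B C p m x hp hx.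
have hx' : homog (odd m) (x : CF R LL (ro_bc R B)) := hx.
have hy : homog (odd (theta_degree cs + sdeg p + m)) (theta_fun (unzip2 cs) (vals p) x).
  rewrite (thetaE (vals p) hcs hx'); apply: homog_scale.
  rewrite (_ : odd _ = odd (box cs + (odd m).+1 + sdeg p)).
    exact: mu_theta_homog.
  rewrite /theta_degree !oddD !oddS oddb; move: (box cs) (sdeg p) => b e.
  by case: (odd b); case: (odd e); case: (odd m).
exact: hy.
Qed.

Lemma theta_is_ainf_hom : theta_ainf_hom theta.
Proof.
move=> cs B C p m x cs0 hcs hp hx.
have hx' : homog (odd m) (x : CF R LL (ro_bc R B)) := hx.
pose S := theta_exp cs (odd m).
(* [T1], [T2] and [T3] are the terms of the relation whose inner operation takes only c's, takes
   only a's, or takes x. *)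
pose T1 i j : CF R LL (ro_bc R C) := (-1) ^+ box (drop (i + j) cs) *:
  mu Fo (theta_word (unzip2 (take i cs) ++ mu Fo (cword (unzip2 (take j (drop i cs))))
                     :: unzip2 (drop (i + j) cs)) (vals p) x).
pose T2 (s : split2 (dE CFk) B C) (t : split2 (dE CFk) (sp_mid s) C) :
    CF R LL (ro_bc R C) := (-1) ^+ (box cs + (odd m).+1 + sdeg (sp_fst s)) *:
  mu Fo (theta_word (unzip2 cs)
    (pcat (psnoc (vals (sp_fst s)) (mu_fuk (vals (sp_fst t)))) (vals (sp_snd t))) x).
pose T3 i (t : split2 (dE CFk) B C) : CF R LL (ro_bc R C) :=
  (-1) ^+ box (drop i cs) *:
  mu Fo (theta_word (unzip2 (drop i cs)) (vals (sp_snd t))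
    (mu Fo (theta_word (unzip2 (take i cs)) (vals (sp_fst t)) x))).
have rel : \sum_(0 <= i < (size cs).+1) \sum_(0 <= j < (size cs - i).+1) T1 i j
    + \sum_(0 <= i < (size cs).+1) \sum_(t <- splits p) T3 i t
    + \sum_(s <- splits p) \sum_(t <- splits (sp_snd s)) T2 s t = 0.
  exact: mu_ainf_theta hcs hp hx'.
have htake i : hletters (take i cs) by move=> c /mem_take; apply: hcs.
have hdrop i : hletters (drop i cs) by move=> c /mem_drop; apply: hcs.
(* The terms whose inner operation has no input. *)
have T1_0 i : T1 i 0%N = 0.
  rewrite /T1 take0 addn0 /= LLW mu_unit_letter ?scaler0//.
  by rewrite !size_map -size_cat cat_take_drop.
have ET1 : \sum_(0 <= i < (size cs).+1) \sum_(0 <= j < (size cs - i).+1) T1 i j =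
    \sum_(0 <= i < size cs) \sum_(1 <= j < (size cs - i).+1) T1 i j.
  rewrite big_nat_recr//= subnn big_nat1 T1_0 addr0; apply: eq_bigr => i _.
  by rewrite big_ltn// T1_0 add0r.
have ET2 : \sum_(s <- splits p) \sum_(t <- splits (sp_snd s)) T2 s t =
    \sum_(s <- splits p) \sum_(t <- splits (sp_snd s) | (0 < plen (sp_fst t))%N) T2 s t.
  apply: eq_bigr => s _; rewrite sum_splits_fst [X in X + _](_ : _ = 0) ?add0r//.
  by rewrite /T2 /= mu_unit_arc ?scaler0// size_map.
(* [G i t] is the signed composite in which c_1, ..., c_i act first. For 0 < i < [size cs] it is a
   summand of [cc_mu2]; at the two ends one factor is [theta_fun [::]], that is [mf_d] or
   [LM_map]. *)
pose G i (t : split2 (dE CFk) B C) : CF R LL (ro_bc R C) :=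
  (-1) ^+ ((theta_degree (drop i cs)).+1 * sdeg (sp_fst t)) *:
  ((-1) ^+ (theta_degree (take i cs) + sdeg (sp_fst t)) *:
   theta_fun (unzip2 (drop i cs)) (vals (sp_snd t))
     (theta_fun (unzip2 (take i cs)) (vals (sp_fst t)) x)).
have deg0 : theta_degree ([::] : letters) = 1%N by rewrite /theta_degree /box big_nil.
have sgnK k (y : CF R LL (ro_bc R C)) : (-1) ^+ k *: ((-1) ^+ k *: y) = y.
  by rewrite scalerA -exprD addnn -signr_odd odd_double scale1r.
(* The two halves of the differential in mf are the end terms in which the empty list of c's meets
   the empty word. *)
have EA : mf_mu1 (theta_degree cs + sdeg p) (theta (unzip2 cs) B C (vals p)) x =
    G (size cs) (Split2 p pnil) + G 0%N (Split2 pnil p).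
  rewrite /mf_mu1 !mf_dE scalerBr /G drop_size take_size drop0 take0.
  rewrite deg0; congr (_ + _).
    by rewrite exprM sqrrN !expr1n scale1r.
  by rewrite sgnK [sdeg _]/= muln0 addn0 scale1r expr1 scaleN1r.
have EB2 : \sum_(s <- splits p | (0 < plen (sp_snd s))%N)
      mf_mu2 (LM_map (vals (sp_snd s))) (theta_degree cs + sdeg (sp_fst s))
        (theta (unzip2 cs) _ _ (vals (sp_fst s))) x =
    \sum_(s <- splits p | (0 < plen (sp_snd s))%N) G (size cs) s.
  apply: eq_bigr => s _; rewrite /mf_mu2 /G drop_size take_size LM_mapE deg0.
  by rewrite exprM sqrrN !expr1n scale1r.
have EB3 : \sum_(s <- splits p | (0 < plen (sp_fst s))%N)
      (-1) ^+ ((theta_degree cs).+1 * sdeg (sp_fst s)) *: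
      mf_mu2 (theta (unzip2 cs) _ _ (vals (sp_snd s))) (sdeg (sp_fst s)).+1
        (LM_map (vals (sp_fst s))) x =
    \sum_(s <- splits p | (0 < plen (sp_fst s))%N) G 0%N s.
  by apply: eq_bigr => s _; rewrite /mf_mu2 /G drop0 take0 LM_mapE deg0.
have EM i : cc_mu2 (theta_degree (drop i cs)) (theta (unzip2 (drop i cs)))
    (theta_degree (take i cs)) (theta (unzip2 (take i cs))) p x =
    \sum_(t <- splits p) G i t.
  by [].
have EG i t : pcat (sp_fst t) (sp_snd t) = p -> G i t = (-1) ^+ S.+1 *: T3 i t.
  move=> tp; have [h1 _] : hwordk (sp_fst t) /\ hwordk (sp_snd t).
    by apply/all_letters_cat; rewrite tp.
  by rewrite /G (theta_comp _ (htake i) (hdrop i) h1 hx') cat_take_drop.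
have ET3 : (-1) ^+ S.+1 *: (\sum_(0 <= i < (size cs).+1) \sum_(t <- splits p) T3 i t) =
    \sum_(0 <= i < (size cs).+1) \sum_(t <- splits p) G i t.
  rewrite scaler_sumr; apply: eq_bigr => i _.
  by rewrite scaler_sumr; apply: eq_sum_splits => t /(EG i) ->.
have EG' : \sum_(0 <= i < (size cs).+1) \sum_(t <- splits p) G i t =
    \sum_(t <- splits p) G 0%N t
    + \sum_(1 <= i < size cs) \sum_(t <- splits p) G i t
    + \sum_(t <- splits p) G (size cs) t.
  (* The two end indices are distinct because [cs] is nonempty. *)
  by rewrite big_nat_recr// big_ltn.
have EB4 : \sum_(s <- splits p) \sum_(t <- splits (sp_snd s) | (0 < plen (sp_fst t))%N)
      (-1) ^+ (theta_degree cs + sdeg (sp_fst s)) *: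
      theta (unzip2 cs) _ _ (pcat (psnoc (vals (sp_fst s)) (mu_fuk (vals (sp_fst t))))
                    (vals (sp_snd t))) x =
    (-1) ^+ S.+1 *: \sum_(s <- splits p) \sum_(t <- splits (sp_snd s)) T2 s t.
  rewrite ET2 scaler_sumr; apply: eq_bigr => s _.
  rewrite scaler_sumr; apply: eq_bigr => t _.
  have -> : theta (unzip2 cs) _ _
      (pcat (psnoc (vals (sp_fst s)) (mu_fuk (vals (sp_fst t)))) (vals (sp_snd t))) x =
      _ :> CF R LL (ro_bc R C) := thetaE _ hcs hx'.
  rewrite /T2 !scalerA -!exprD; congr (_ *: _); apply: signr_parity.
  rewrite /S /theta_degree /theta_sign /theta_exp mulSn.
  move: (sdeg (sp_fst s)) (box cs) (tri cs) (size cs).+1 (odd m).+1 => e b t' l k.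
  rewrite !(oddD, oddM, oddS).
  move: (odd b) (odd t') (odd l) (odd e) (odd k).
  by do 5 case.
have EL : cc_mu1 (theta_degree cs) (theta (unzip2 cs)) p x
    + \sum_(1 <= i < size cs)
      cc_mu2 (theta_degree (drop i cs)) (theta (unzip2 (drop i cs)))
             (theta_degree (take i cs)) (theta (unzip2 (take i cs))) p x =
    (-1) ^+ S.+1 *: (\sum_(0 <= i < (size cs).+1) \sum_(t <- splits p) T3 i t
      + \sum_(s <- splits p) \sum_(t <- splits (sp_snd s)) T2 s t).
  rewrite scalerDr ET3 EG' (sum_splits_fst p (G 0%N)) (sum_splits_snd p (G (size cs))).
  rewrite /cc_mu1 EA EB2 EB3 EB4 (eq_bigr _ (fun i _ => EM i)).
  (* Regroups the six summands as i = 0, interior i, i = [size cs], and the terms in the Fukaya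
     operations. *)
  by rewrite [LHS](AC 6 (((2*4)*6*(1*3))*5)).
have ER : \sum_(0 <= i < size cs) \sum_(1 <= j < (size cs - i).+1)
      (-1) ^+ box (take i cs) *:
      theta (unzip2 (take i cs) ++
             mu_op Fo (take j (drop i cs)) :: unzip2 (drop (i + j) cs)) _ _ (vals p) x =
    (-1) ^+ S *: (\sum_(0 <= i < size cs) \sum_(1 <= j < (size cs - i).+1) T1 i j).
  rewrite scaler_sumr; apply: eq_bigr => i _; rewrite scaler_sumr; apply: eq_bigr => j _.
  have hmid : hletters (take j (drop i cs)) by move=> c /mem_take; apply: hdrop.
  have ecs : take i cs ++ take j (drop i cs) ++ drop (i + j) cs = cs.
    by rewrite addnC -drop_drop !cat_take_drop.
  have := theta_mu_op (vals p) (htake i) hmid (hdrop (i + j)%N) hx'.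
  by rewrite ecs; apply.
move: rel; rewrite -addrA => /eqP; rewrite addr_eq0 => /eqP rel.
by rewrite EL ER -ET1 rel scalerN exprS mulN1r scaleNr.
Qed.

Lemma theta_fun0 (cs : seq A) (B C : fk) (p : cpath CFk B C) :
  theta_fun cs p (0 : CF R LL (ro_bc R B)) = 0.
Proof.
have := cc_linear (theta cs) p (-1) 0 0.
by rewrite scaler0 addr0 scaleN1r addNr; apply.
Qed.

Lemma theta_unit (B C : fk) (p : cpath (dE CFk) B C) dx (x : CF R LL (ro_bc R B)) :
  homog dx x -> theta_fun [:: unit_cf Fo LL] (vals p) x = cc_one (LLW := LLW) p x.
Proof.
move=> hx; have hcs : hletters [:: (false, unit_cf Fo LL)].
  by move=> c; rewrite inE => /eqP ->; apply: unit_deg.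
rewrite (thetaE (vals p) hcs hx) -signr_odd.
(* The unit has degree 0, so [box] and the size are both 1 and [tri] is 0: the sign is trivial. *)
have -> : odd (theta_sign [:: (false, unit_cf Fo LL)] dx) = false.
  by rewrite /theta_sign tri_cons box_cons /box big_nil muln0 !oddD oddM.
rewrite expr0 scale1r; case: C / p => [|C1 C2 p a].
  exact: (@unit_mu2r _ _ _ Fo R LL (ro_bc R B) x).
have -> q : theta_word (unzip2 [:: (false, unit_cf Fo LL)]) q x =
    pcat (psnoc (E := CFo R) pnil (unit_cf Fo LL)) (pcat (word1 x) (fk_bc R q)).
  by rewrite pcatA.
by rewrite unit_mu3// plen_cat.
Qed.

Lemma theta_cohom_unital : theta_cohomologically_unital theta.
Proof.
pose z B C (p : cpath CFk B C) : mf_mod (LM B) -> mf_mod (LM C) := fun=> 0.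
have zlin B C (p : cpath CFk B C) : linear (z B C p).
  by move=> r a b; rewrite /z scaler0 addr0.
have zmulti B C1 C2 C (p : cpath CFk B C1) (q : cpath CFk C2 C) (r : Lam)
      (a b : CFk C1 C2) x : z _ _ (pcat (psnoc p (r *: a + b)) q) x =
      ((r : novikov K)%:A : R) *: z _ _ (pcat (psnoc p a) q) x
        + z _ _ (pcat (psnoc p b) q) x.
  by rewrite /z scaler0 addr0.
exists (Cochain zlin zmulti); split.
  by move=> B C p m x _ _ i _; rewrite ffunE.
move=> B C p m x hp hx; have hx' : homog (odd m) (x : CF R LL (ro_bc R B)) := hx.
have -> : cc_mu1 1 (Cochain zlin zmulti) p x = 0.
  rewrite /cc_mu1 /mf_mu1 /mf_mu2 [X in X + _ + _ + _](_ : _ = 0); last first.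
    by rewrite mf_d0 scaler0 subr0 scaler0.
  rewrite [X in 0 + X]big1 ?[X in 0 + 0 + X]big1 ?[X in 0 + 0 + 0 + X]big1 ?addr0//.
  - by move=> s _; apply: big1 => t _; rewrite scaler0.
  - by move=> s _; rewrite !scaler0.
  - by move=> s _; rewrite LM_mapE theta_fun0 scaler0.
rewrite addr0; exact: theta_unit hx'.
Qed.

Lemma theta_extends_action : theta_extends_module_action theta.
Proof.
move=> B; exists (fun _ _ => 0); split.
- by move=> c r a b; rewrite scaler0 addr0.
- by move=> r a b x; rewrite scaler0 addr0.
- by move=> d c m x _ _ i _; rewrite ffunE.
move=> d c m x hc hx; have hx' : homog (odd m) (x : CF R LL (ro_bc R B)) := hx.
rewrite /mf_mu1 mf_d0 scaler0 subr0 scaler0 addr0.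
have hcs : hletters [:: (d, c)] by move=> c'; rewrite inE => /eqP ->.
have := thetaE (pnil : cpath CFk B B) hcs hx'.
rewrite [cc_map _ _ _]/= => ->.
apply/eqP; rewrite subr_eq0; apply/eqP; congr (_ *: _); apply: signr_parity.
(* For a single letter the exponent is (d + 2)(m + 1) + 2 modulo 2, which has the parity of
   [d * m + d]. *)
rewrite /theta_sign tri_cons box_cons /box big_nil muln0 addn0 !oddD !oddM !oddS !oddb.
by case: (odd m); case: (d).
Qed.
End Construction.

Theorem theoremA (K : realType) (X : symplectic K) (F : floer_data X)
    (Fo : foundations F) (R : cfalg K) (eps : augmentation R)
    (lam : nov_cfalg K) (L : fuk Fo lam)
    (LL : robj F R) (W : R) (LLW : curvature Fo LL W)
    (lift : is_lift eps L LL) :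
  exists Theta : seq (CF R LL LL) -> cochain lam LLW,
    [/\ theta_counts_discs Theta,
        theta_multilinear Theta /\ theta_graded Theta,
        theta_ainf_hom Theta,
        theta_cohomologically_unital Theta
      & theta_extends_module_action Theta].
Proof.
exists (theta lam LLW); split.
- exact: theta_disc_counts.
- by split; [exact: theta_is_multilinear | exact: theta_is_graded].
- exact: theta_is_ainf_hom.
- exact: theta_cohom_unital.
- exact: theta_extends_action.
Qed.
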